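(* Let $x_0\in\mathbb{R}^N$, $R>0$, and let $x^*$ denote the inversion of $x$ with respect to the sphere $S_R(x_0)$. Let $\Omega$ be an open bounded Lipschitz set and let $u:\mathbb{R}^N\to\mathbb{R}$ be a measurable function with $u\equiv0$ on $\mathbb{R}^N\setminus\Omega$. Let $u^*$ be the Kelvin transform of $u$ with respect to $S_R(x_0)$. (i) If $u$ is Dini continuous in $x\neq x_0$, then $u^*$ is Dini continuous in $x^*$ and $$L_\Delta u^*(x^* )=|x^*|^{-N}L_\Delta u(x)+c_N|x^*|^{-2N}u(x)\int_\Omega\frac{|z|^{-N}-|x|^{-N}}{|z-x|^N}\,dz+\big(h_{\Omega^*}(x^* )-h_\Omega(x)\big)|x^*|^{-N}u(x).$$ (ii) If $u,\,L_\Delta u\in L^\infty(\Omega)$ and $B_R(x_0)\subset\Omega^c$, then $u^*,\,L_\Delta u^*\in L^\infty(\Omega^* )$. (iii) If $B_R(x_0)\subset\Omega^c$ and $u\in\mathbb{H}(\Omega)$, then $u^*\in\mathbb{H}(\Omega^* )$.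
   Context: Notation: $N\ge1$; $B_r(x)$ is the open ball in $\mathbb{R}^N$ of radius $r$ centered at $x$, $S_r(x)=\partial B_r(x)$, $\Omega^c=\mathbb{R}^N\setminus\Omega$. Inversion with respect to $S_R(x_0)$: $x^*=x_0+R^2\frac{x-x_0}{|x-x_0|^2}$ for $x\ne x_0$; $\Omega^*=\{x^*:x\in\Omega\}$. Kelvin transform of $u$ with respect to $S_R(x_0)$: $u^*(x^* )=|x^*-x_0|^{-N}u(x)$ for $x^*\ne x_0$. Constants: $c_N=\pi^{-N/2}\Gamma(N/2)$, $\rho_N=2\ln2+\Psi(N/2)-\gamma$, with $\Psi=\Gamma'/\Gamma$ the digamma function and $\gamma=-\Gamma'(1)$. The logarithmic Laplacian (the operator with Fourier symbol $2\ln|\xi|$) is $L_\Delta u(x)=c_N\int_{B_1(x)}\frac{u(x)-u(y)}{|x-y|^N}dy-c_N\int_{\mathbb{R}^N\setminus B_1(x)}\frac{u(y)}{|x-y|^N}dy+\rho_Nu(x)$. For a set $U\subset\mathbb{R}^N$: $h_U(x)=c_N\Big(\int_{B_1(x)\setminus U}|x-y|^{-N}dy-\int_{U\setminus B_1(x)}|x-y|^{-N}dy\Big)$. Dini continuity: for a measurable function $v:U\to\mathbb{R}$ and $x\in U$, let $\omega_{v,x,U}(r)=\sup_{y\in U,\,|y-x|\le r}|v(y)-v(x)|$ for $r>0$; $v$ is Dini continuous at $x$ if $\int_0^1\frac{\omega_{v,x,U}(r)}{r}dr<\infty$. $\mathbb{H}(U)$ is the space of $u\in L^2(\mathbb{R}^N)$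 with $u=0$ in $\mathbb{R}^N\setminus U$ and $\iint_{|x-y|\le1}\frac{|u(x)-u(y)|^2}{|x-y|^N}dx\,dy<\infty$.
   Formalization: In (i), |x*|, |z|, |x| become distances to x_0 and the second term gains R^{2N} (printed form is x_0=0, R=1); the formula assumes u integrable and u(x)=0 or x_0 not in the closure of Ω (otherwise terms are infinite); Dini continuity is meant in some neighbourhood of the point. *)

(* Defs.v *)
From HB Require Import structures.
From mathcomp Require Import all_boot all_order all_algebra.
From mathcomp Require Import all_classical all_reals all_analysis.

Set Implicit Arguments.
Unset Strict Implicit.
Unset Printing Implicit Defensive.

Import Order.TTheory GRing.Theory Num.Theory.
Import numFieldNormedType.Exports.

Local Open Scope classical_set_scope.
Local Open Scope ring_scope.

Definition measure_rV_display : measure_display.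
Proof. exact: default_measure_display. Qed.

Section measurable_rV.
Context {R : realType} (n : nat).

Let coors : 'I_n -> 'rV[R]_n -> R := fun i v => v ord0 i.

Let rV_set0 : g_sigma_preimage coors set0.
Proof. exact: sigma_algebra0. Qed.

Let rV_setC A : g_sigma_preimage coors A -> g_sigma_preimage coors (~` A).
Proof. exact: sigma_algebraC. Qed.

Let rV_bigcup (F : _^nat) : (forall i, g_sigma_preimage coors (F i)) ->
  g_sigma_preimage coors (\bigcup_i (F i)).
Proof. exact: sigma_algebra_bigcup. Qed.

HB.instance Definition _ := @isMeasurable.Build measure_rV_display
  'rV[R]_n (g_sigma_preimage coors) rV_set0 rV_setC rV_bigcup.

End measurable_rV.

Section rV_cons.
Context {R : realType}.
Implicit Types n : nat.

Lemma measurable_coord n (i : 'I_n) :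
  measurable_fun [set: 'rV[R]_n] (fun v : 'rV[R]_n => v ord0 i).
Proof.
move=> _ Y mY; rewrite setTI; apply: sub_sigma_algebra => /=.
rewrite -bigcup_seq/=; exists i => /=; first by rewrite mem_index_enum.
by exists Y => //; rewrite setTI.
Qed.

Lemma measurable_fun_rV d (T : measurableType d) n (f : T -> 'rV[R]_n) :
  (forall i, measurable_fun [set: T] (fun t => f t ord0 i)) ->
  measurable_fun [set: T] f.
Proof.
move=> mf; apply: (@measurability _ _ _ _ _ _
  (\big[setU/set0]_(i < n) preimage_set_system setT
     (fun v : 'rV[R]_n => v ord0 i) measurable)) => //.
move=> _ [B + <-].
rewrite -bigcup_seq => -[i _ [C mC <-]].
rewrite setTI -comp_preimage; exact: mf.
Qed.

Definition rV_cons n (p : measurableTypeR R * 'rV[R]_n) : 'rV[R]_n.+1 :=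
  \row_i (if unlift ord0 i is Some j then p.2 ord0 j else p.1).

Definition rV_uncons n (v : 'rV[R]_n.+1) : measurableTypeR R * 'rV[R]_n :=
  (v ord0 ord0, \row_j v ord0 (lift ord0 j)).

Lemma rV_cons0 n (p : measurableTypeR R * 'rV[R]_n) : rV_cons p ord0 ord0 = p.1.
Proof. by rewrite mxE unlift_none. Qed.

Lemma rV_consS n (p : measurableTypeR R * 'rV[R]_n) j :
  rV_cons p ord0 (lift ord0 j) = p.2 ord0 j.
Proof. by rewrite mxE liftK. Qed.

Lemma rV_consK n : cancel (@rV_cons n) (@rV_uncons n).
Proof.
move=> [t v]; rewrite /rV_uncons rV_cons0; congr (_, _).
by apply/rowP => j; rewrite mxE rV_consS.
Qed.

Lemma measurable_rV_cons n : measurable_fun [set: measurableTypeR R * 'rV[R]_n] (@rV_cons n).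
Proof.
apply: measurable_fun_rV => i; case: (unliftP ord0 i) => [j|] ->.
  under eq_fun do rewrite rV_consS.
  exact: measurableT_comp (measurable_coord j) measurable_snd.
by under eq_fun do rewrite rV_cons0; exact: measurable_fst.
Qed.

Lemma measurable_rV_uncons n : measurable_fun [set: 'rV[R]_n.+1] (@rV_uncons n).
Proof.
apply/measurable_fun_pair; first exact: measurable_coord.
apply: measurable_fun_rV => i; under eq_fun do rewrite mxE.
exact: measurable_coord.
Qed.

End rV_cons.

Section lebesgue_rV.
Context {R : realType}.

Section step.
Variables (n : nat) (m : {sigma_finite_measure set 'rV[R]_n -> \bar R}).

Definition lebesgue_rV_step : set 'rV[R]_n.+1 -> \bar R :=
  pushforward (@lebesgue_measure R \x m)%E (@rV_cons R n).

Let measurable_preimage_cons (A : set 'rV[R]_n.+1) :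
  measurable A -> measurable (@rV_cons R n @^-1` A).
Proof. by move=> mA; rewrite -[X in measurable X]setTI; exact: measurable_rV_cons. Qed.

Let step0 : lebesgue_rV_step set0 = 0%E.
Proof. by rewrite /lebesgue_rV_step /pushforward preimage_set0 measure0. Qed.

Let step_ge0 A : (0 <= lebesgue_rV_step A)%E.
Proof. by rewrite /lebesgue_rV_step /pushforward; exact: measure_ge0. Qed.

Let step_sigma_additive : semi_sigma_additive lebesgue_rV_step.
Proof.
move=> F mF tF mUF; rewrite /lebesgue_rV_step /pushforward preimage_bigcup.
apply: measure_semi_sigma_additive.
- by move=> k; exact: measurable_preimage_cons.
- apply/trivIsetP => /= i j _ _ ij; rewrite -preimage_setI.
  by move/trivIsetP : tF => /(_ _ _ _ _ ij) ->//; rewrite preimage_set0.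
- by rewrite -preimage_bigcup; exact: measurable_preimage_cons.
Qed.

HB.instance Definition _ := isMeasure.Build _ _ _ lebesgue_rV_step
  step0 step_ge0 step_sigma_additive.

Let step_sigma_finite : sigma_finite setT lebesgue_rV_step.
Proof.
have /sigma_finiteP[F [TF ndF Foo]] := sigma_finiteT (@lebesgue_measure R).
have /sigma_finiteP[G [TG ndG Goo]] := sigma_finiteT m.
exists (fun k => @rV_uncons R n @^-1` (F k `*` G k)).
  rewrite -preimage_bigcup; apply/esym; rewrite -subTset => v _ /=.
  move: (rV_uncons v) => -[t w].
  have [i _ Fit] : (\bigcup_k F k) t by rewrite -TF.
  have [j _ Gjw] : (\bigcup_k G k) w by rewrite -TG.
  exists (maxn i j) => //; split => /=.
    by move: t Fit; exact/subsetPset/ndF/leq_maxl.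
  by move: w Gjw; exact/subsetPset/ndG/leq_maxr.
move=> k; have [mF Fk] := Foo k; have [mG Gk] := Goo k; split.
  rewrite -[X in measurable X]setTI; apply: measurable_rV_uncons => //.
  exact: measurableX.
rewrite /lebesgue_rV_step /pushforward -comp_preimage.
rewrite (_ : _ \o _ = id) ?preimage_id; last first.
  by apply/funext => p /=; rewrite rV_consK.
by rewrite product_measure1E// lte_mul_pinfty// ge0_fin_numE.
Qed.

HB.instance Definition _ := Measure_isSigmaFinite.Build _ _ _ lebesgue_rV_step
  step_sigma_finite.

End step.

Fixpoint lebesgue_rV n : {sigma_finite_measure set 'rV[R]_n -> \bar R} :=
  if n is n'.+1 then lebesgue_rV_step (lebesgue_rV n') else dirac (0 : 'rV[R]_0).

Lemma lebesgue_rV_box n (A : 'I_n -> set R) : (forall i, measurable (A i)) ->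
  lebesgue_rV n [set v | forall i, A i (v ord0 i)] =
  (\prod_(i < n) lebesgue_measure (A i))%E.
Proof.
elim: n A => [|n IHn] A mA.
  by rewrite big_ord0 /= diracE mem_set// => -[].
rewrite big_ord_recl -IHn//= /lebesgue_rV_step /pushforward.
pose B := [set v : 'rV[R]_n | forall i, A (lift ord0 i) (v ord0 i)].
have mB : measurable B.
  rewrite (_ : B =
      \bigcap_i [set v : 'rV[R]_n | A (lift ord0 i) (v ord0 i)]).
    apply: fin_bigcap_measurable => // i _.
    rewrite -[X in measurable X]setTI.
    exact: (@measurable_coord R n i measurableT _ (mA (lift ord0 i))).
  apply/seteqP; split => v Bv.
    by move=> i _; exact: (Bv i).
  by move=> i; exact: (Bv i I).
rewrite (_ : _ @^-1` _ = A ord0 `*` B); first exact: (product_measure1E lebesgue_measure (lebesgue_rV n) (mA ord0) mB).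
apply/seteqP; split => -[t v] /=.
  move=> Atv; split; first by have := Atv ord0; rewrite rV_cons0.
  by move=> i; have := Atv (lift ord0 i); rewrite rV_consS.
move=> [At Av] i; case: (unliftP ord0 i) => [j|] ->.
  by rewrite rV_consS; exact: Av.
by rewrite rV_cons0.
Qed.

End lebesgue_rV.

Section euclidean.
Context {R : realType} {N : nat}.
Implicit Types (x y e p : 'rV[R]_N) (U : set 'rV[R]_N).

Definition dotp x y : R := \sum_i x ord0 i * y ord0 i.

(* The library norm on row vectors is the maximum norm; it induces the same
   topology, bounded sets and Lipschitz functions. *)
Definition enorm x : R := Num.sqrt (dotp x x).

Definition eball x (r : R) : set 'rV[R]_N := [set y | enorm (y - x) < r].

(* Near each boundary point, U is the strict epigraph, in the direction of some
   unit vector e, of a Lipschitz function phi; phi is only evaluated on the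
   hyperplane orthogonal to e. *)
Definition lipschitz_set U : Prop :=
  forall p, (closure U `\` interior U) p ->
  exists e (phi : 'rV[R]_N -> R) (r : R),
    [/\ enorm e = 1, lipschitz phi, 0 < r &
        forall y, eball p r y ->
          (U y <-> phi (y - dotp y e *: e) < dotp y e)].

(* As 0^-1 = 0, the centre x0 is mapped to itself; it is removed in
   [inversion_set]. *)
Definition inversion x0 (r : R) x : 'rV[R]_N :=
  x0 + (r ^+ 2 / enorm (x - x0) ^+ 2) *: (x - x0).

Definition inversion_set x0 (r : R) U : set 'rV[R]_N :=
  inversion x0 r @` (U `\ x0).

(* The inversion is an involution of the complement of x0, so that
   kelvin x0 r u (inversion x0 r x) = enorm (inversion x0 r x - x0) ^- N * u x
   for x != x0. For N > 0 the value at x0 is 0. *)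
Definition kelvin x0 (r : R) (u : 'rV[R]_N -> R) : 'rV[R]_N -> R :=
  fun y => enorm (y - x0) ^- N * u (inversion x0 r y).

Definition modulus U (v : 'rV[R]_N -> R) x (r : R) : \bar R :=
  ereal_sup [set `|v y - v x|%:E | y in [set y | U y /\ enorm (y - x) <= r]].

Definition dini_continuous_in U (v : 'rV[R]_N -> R) x : Prop :=
  (\int[lebesgue_measure]_(r in `]0%R, 1%R[) (modulus U v x r * (r^-1)%:E)
    < +oo)%E.

(* Continuity at a point being a local notion, U may be any neighbourhood of x:
   with U the whole space the condition would moreover force v to be bounded on
   every ball of radius less than 1 about x. *)
Definition dini_continuous (v : 'rV[R]_N -> R) x : Prop :=
  exists U, [/\ open U, U x & dini_continuous_in U v x].

Definition in_Linfty U (f : 'rV[R]_N -> R) : Prop :=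
  f \_ U \in Lfun (lebesgue_rV N) +oo%E.

Definition in_H U (u : 'rV[R]_N -> R) : Prop :=
  [/\ u \in Lfun (lebesgue_rV N) 2%:E,
      forall x, ~ U x -> u x = 0 &
      (\int[lebesgue_rV N \x lebesgue_rV N]_(p in
          [set p : 'rV[R]_N * 'rV[R]_N | (enorm (p.1 - p.2) <= 1)%R])
        (`|u p.1 - u p.2| ^+ 2 / enorm (p.1 - p.2) ^+ N)%:E < +oo)%E].

End euclidean.

Section constants.
Context {R : realType}.

Definition Gamma (s : R) : R :=
  \int[lebesgue_measure]_(t in `]0, +oo[) (t `^ (s - 1) * expR (- t)).

Definition digamma (s : R) : R := derive1 Gamma s / Gamma s.

Definition euler_gamma : R := - derive1 Gamma 1.

Definition c_ (N : nat) : R := pi `^ (- (N%:R / 2)) * Gamma (N%:R / 2).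

Definition rho_ (N : nat) : R :=
  2 * ln 2 + digamma (N%:R / 2) - euler_gamma.

End constants.

Section log_laplacian.
Context {R : realType} {N : nat}.
Local Notation mu := (lebesgue_rV N).
Implicit Types (x : 'rV[R]_N) (u : 'rV[R]_N -> R) (U : set 'rV[R]_N).

(* The integrals below are real-valued, with a junk value when they diverge;
   the predicates [loglap_defined] and [h_defined] express that all the
   integrals involved converge absolutely. *)
Definition loglap_defined u x : Prop :=
  mu.-integrable (eball x 1)
    (fun y => ((u x - u y) / enorm (x - y) ^+ N)%:E) /\
  mu.-integrable (~` eball x 1) (fun y => (u y / enorm (x - y) ^+ N)%:E).

Definition loglap u x : R :=
  c_ N * \int[mu]_(y in eball x 1) ((u x - u y) / enorm (x - y) ^+ N)
  - c_ N * \int[mu]_(y in ~` eball x 1) (u y / enorm (x - y) ^+ N)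
  + rho_ N * u x.

Definition h_defined U x : Prop :=
  mu.-integrable (eball x 1 `\` U) (fun y => (enorm (x - y) ^- N)%:E) /\
  mu.-integrable (U `\` eball x 1) (fun y => (enorm (x - y) ^- N)%:E).

Definition h_ U x : R :=
  c_ N * (\int[mu]_(y in eball x 1 `\` U) (enorm (x - y) ^- N)
          - \int[mu]_(y in U `\` eball x 1) (enorm (x - y) ^- N)).

(* The factor of u(x) in the first correction term of the Kelvin formula. *)
Definition kelvin_kernel x0 x (z : 'rV[R]_N) : R :=
  (enorm (z - x0) ^- N - enorm (x - x0) ^- N) / enorm (z - x) ^+ N.

End log_laplacian.

(* Main.v *)
Require Import Defs.
From HB Require Import structures.
From mathcomp Require Import all_boot all_order all_algebra.
From mathcomp Require Import all_classical all_reals all_analysis.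
From mathcomp Require Import ring lra measurable_realfun ess_sup_inf.

(** The map [inversion x0 r] is conformal: it multiplies the distance of [x] and
    [z] by [r ^+ 2 / (enorm (x - x0) * enorm (z - x0))]
    ([enorm_inversion_sub]), and its Jacobian at [z] is
    [(r / enorm (z - x0)) ^+ (2 * N)]. The kernel [enorm (x - y) ^- N] and the
    weight of the Kelvin transform are powers of the same quantities, so under
    the substitution [y = inversion x0 r z] everything cancels in the integral
    that defines [loglap] except the commutator kernel [kelvin_kernel]
    ([diff_quotient_kelvin]). A function that vanishes off [U] satisfies
    [loglap u x = c_ N * \int_U (u x - u y) / enorm (x - y) ^+ N
    + (rho_ N + h_ U x) * u x] ([loglapE]); applying this on both sides and
    changing variables yields the transformation formula ([kelvin_loglap]).

    The change of variables for the inversion is obtained without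
    differential calculus ([ge0_integral_inversion]). The inversion preserves
    the rays from [x0], and the Lebesgue integral is an average of ray
    integrals for the Haar measure of the dilation group: this uses Tonelli and
    the behaviour of Lebesgue measure under dilations only ([integral_rays]).
    In the additive parameter of a ray, the inversion is a reflection of the
    line, which preserves one-dimensional Lebesgue measure.

    Dini continuity makes the difference quotient integrable near [x]: Tonelli
    turns the integral of [modulus (enorm (z - x)) * enorm (z - x) ^- N] over a
    ball into the one-dimensional Dini integral ([integral_radial_le]). It passes
    to the Kelvin transform since the inversion and its weight are Lipschitz
    near [inversion x0 r x] ([dini_kelvin]).

    If [U] avoids a ball about [x0] and is bounded, it lies in a shell
    [d <= enorm (z - x0) <= D], as does its image. There the kernel
    [kelvin_kernel x0 x z] is at most a multiple of
    [enorm (x - z) / enorm (x - z) ^+ N], whose integral over balls is bounded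
    uniformly in [x]. Each of the functions [h_] blows up at the boundary, but
    their difference is bounded ([h_inversion_bounded]), because after the
    change of variables the two kernels differ by the same potential. So all
    terms of the formula are bounded ([kelvin_Linfty]). For the energy space
    the change of variables is applied in both variables to the pairs of nearby
    points; the remaining pairs are controlled by the square norm
    ([kelvin_in_H]). *)

Set Implicit Arguments.
Unset Strict Implicit.
Unset Printing Implicit Defensive.

Import Order.TTheory GRing.Theory Num.Theory.
Import numFieldNormedType.Exports.

Local Open Scope classical_set_scope.
Local Open Scope ring_scope.

(** * Euclidean norm, topology and Borel sets of row vectors *)

Section euclidean_norm.
Context {R : realType} {N : nat}.
Implicit Types (x y z : 'rV[R]_N) (U : set 'rV[R]_N).

Lemma dotpC x y : dotp x y = dotp y x.
Proof. by apply: eq_bigr => i _; rewrite mulrC. Qed.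

Lemma dotpDl x y z : dotp (x + y) z = dotp x z + dotp y z.
Proof. by rewrite -big_split; apply: eq_bigr => i _; rewrite mxE mulrDl. Qed.

Lemma dotpZl a x y : dotp (a *: x) y = a * dotp x y.
Proof. by rewrite mulr_sumr; apply: eq_bigr => i _; rewrite mxE mulrA. Qed.

Lemma dotpDr x y z : dotp x (y + z) = dotp x y + dotp x z.
Proof. by rewrite dotpC dotpDl !(dotpC x). Qed.

Lemma dotpZr a x y : dotp x (a *: y) = a * dotp x y.
Proof. by rewrite dotpC dotpZl dotpC. Qed.

Lemma dotpp_ge0 x : 0 <= dotp x x.
Proof. by apply: sumr_ge0 => i _; rewrite -expr2 sqr_ge0. Qed.

Lemma dotpp_eq0 x : (dotp x x == 0) = (x == 0).
Proof.
apply/eqP/eqP => [/eqP|->]; last by rewrite /dotp big1// => i _; rewrite mxE mul0r.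
rewrite psumr_eq0 => [/allP x0|i _]; last by rewrite -expr2 sqr_ge0.
apply/rowP => i; rewrite mxE; apply/eqP; have := x0 i (mem_index_enum _).
by rewrite mulf_eq0 orbb.
Qed.

Lemma enorm_ge0 x : 0 <= enorm x.
Proof. exact: sqrtr_ge0. Qed.

Lemma sqr_enorm x : enorm x ^+ 2 = dotp x x.
Proof. by rewrite sqr_sqrtr// dotpp_ge0. Qed.

Lemma enorm_eq0 x : (enorm x == 0) = (x == 0).
Proof. by rewrite -dotpp_eq0 -sqr_enorm sqrf_eq0. Qed.

Lemma enorm0 : enorm (0 : 'rV[R]_N) = 0.
Proof. by apply/eqP; rewrite enorm_eq0. Qed.

Lemma enorm_gt0 x : (0 < enorm x) = (x != 0).
Proof. by rewrite lt_def enorm_ge0 enorm_eq0 andbT. Qed.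

Lemma enormB_gt0 x y : (0 < enorm (x - y)) = (x != y).
Proof. by rewrite enorm_gt0 subr_eq0. Qed.

Lemma enormZ a x : enorm (a *: x) = `|a| * enorm x.
Proof.
rewrite /enorm dotpZl dotpZr mulrA -expr2 sqrtrM ?sqr_ge0//.
by rewrite sqrtr_sqr.
Qed.

Lemma enormN x : enorm (- x) = enorm x.
Proof. by rewrite -scaleN1r enormZ normrN1 mul1r. Qed.

Lemma enormC x y : enorm (x - y) = enorm (y - x).
Proof. by rewrite -enormN opprB. Qed.

(** Expanding the square of [enorm y *: x - enorm x *: y]. *)
Lemma dotp_le_enorm x y : dotp x y <= enorm x * enorm y.
Proof.
have [->|x0] := eqVneq x 0; first by rewrite enorm0 mul0r /dotp big1// => i _; rewrite mxE mul0r.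
have [->|y0] := eqVneq y 0; first by rewrite enorm0 mulr0 /dotp big1// => i _; rewrite mxE mulr0.
have := dotpp_ge0 (enorm y *: x + (- enorm x) *: y).
rewrite !(dotpDl, dotpDr, dotpZl, dotpZr) -!sqr_enorm (dotpC y x).
have : 0 < enorm x * enorm y by rewrite mulr_gt0// enorm_gt0.
by set a := enorm x; set b := enorm y; set c := dotp x y; nra.
Qed.

Lemma enormD x y : enorm (x + y) <= enorm x + enorm y.
Proof.
rewrite -(@ler_pXn2r _ 2)// ?nnegrE ?addr_ge0 ?enorm_ge0//.
rewrite sqrrD !sqr_enorm dotpDl !dotpDr (dotpC y x).
by have := dotp_le_enorm x y; lra.
Qed.

Lemma enorm_triangle y x z : enorm (x - z) <= enorm (x - y) + enorm (y - z).
Proof. by apply: le_trans (enormD _ _); rewrite subrKA. Qed.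

Lemma coord_le_enorm x i : `|x ord0 i| <= enorm x.
Proof.
rewrite -sqrtr_sqr ler_wsqrtr// expr2 [leRHS](bigD1 i)//= lerDl.
by apply: sumr_ge0 => j _; rewrite -expr2 sqr_ge0.
Qed.

(** The library topology, balls and bounded sets on row vectors come from the
    maximum norm; this bound and [coord_le_enorm] transfer them to [enorm]. *)
Lemma enorm_le_coord x (e : R) :
  (forall i, `|x ord0 i| <= e) -> enorm x <= N%:R * e.
Proof.
move=> xe; have [N0|[i0]] : N = 0%N \/ inhabited 'I_N.
  by case: N {x xe} => [|n]; [left|right; constructor; exact: ord0].
  have -> : x = 0 by apply/rowP => i; have := ltn_ord i; rewrite {2}N0.
  by rewrite enorm0 N0 mul0r.
have e0 : 0 <= e by rewrite (le_trans _ (xe i0)).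
rewrite -(@ler_pXn2r _ 2)// ?nnegrE ?mulr_ge0 ?enorm_ge0//.
rewrite sqr_enorm (@le_trans _ _ (\sum_(i < N) e ^+ 2))//.
  apply: ler_sum => i _; rewrite -expr2 -real_normK ?num_real//.
  by rewrite lerXn2r// nnegrE.
rewrite sumr_const card_ord -[leLHS]mulr_natl exprMn ler_wpM2r ?sqr_ge0//.
by rewrite -natrX ler_nat expnS expn1 leq_pmull// (leq_trans _ (ltn_ord i0)).
Qed.

Lemma nbhs_eballP x (A : set 'rV[R]_N) :
  nbhs x A <-> exists2 e, 0 < e & eball x e `<=` A.
Proof.
split=> [/nbhs_ballP[e /= e0 eA]|[e e0 eA]].
  exists e => // y xy; apply: eA; split => // i j.
  rewrite /ball/= ord1 (le_lt_trans _ xy)// (le_trans _ (coord_le_enorm _ j))//.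
  by rewrite !mxE distrC.
apply/nbhs_ballP; exists (e / N.+1%:R) => /=; first by rewrite divr_gt0.
move=> y [_ xy]; apply: eA.
rewrite /eball/= (@le_lt_trans _ _ (N%:R * (e / N.+1%:R)))//.
  apply: enorm_le_coord => i; rewrite !mxE distrC.
  exact: ltW (xy ord0 i).
by rewrite mulrCA gtr_pMr// ltr_pdivrMr// mul1r ltr_nat.
Qed.

Lemma openE_eball U : open U <-> forall x, U x -> exists2 e, 0 < e & eball x e `<=` U.
Proof.
by rewrite openE; split=> [oU x /oU /nbhs_eballP//|oU x Ux]; apply/nbhs_eballP/oU.
Qed.

Lemma eball_open x e : open (eball x e).
Proof.
apply/openE_eball => y xy; exists (e - enorm (y - x)); first by rewrite subr_gt0.
by move=> z /=; rewrite /eball /= => yz; have := enorm_triangle y z x; lra.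
Qed.

Lemma eballxx x e : 0 < e -> eball x e x.
Proof. by move=> e0; rewrite /eball/= subrr enorm0. Qed.

Lemma bounded_set_enorm U x :
  bounded_set U -> exists2 D, 0 < D & forall z, U z -> enorm (z - x) <= D.
Proof.
move=> [M [Mr UM]]; have UM1 := UM (`|M| + 1).
exists (N%:R * (`|M| + 1) + enorm x + 1).
  by rewrite ltr_pwDr// addr_ge0 ?enorm_ge0// mulr_ge0// addr_ge0.
move=> z Uz; rewrite (le_trans (enormD _ _))// enormN ler_wpDr// lerD2r; apply: enorm_le_coord => i.
have /UM1 /(_ z Uz) : M < `|M| + 1 by rewrite (le_lt_trans (ler_norm M))// ltrDl.
apply: le_trans; rewrite -[leRHS]/(mx_norm z) mx_normrE.
exact: (le_bigmax _ (fun ij : 'I_1 * 'I_N => `|z ij.1 ij.2|) (ord0, i)).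
Qed.

End euclidean_norm.

Lemma measurable_funV {R : realType} d (T : measurableType d) (f : T -> R) :
  measurable_fun setT f -> measurable_fun setT (fun t => (f t)^-1).
Proof.
(* This identity also holds at the zeros of [f], both sides being [0]. *)
move=> mf; rewrite (_ : (fun t => _) = fun t => f t * (f t ^+ 2) `^ (-1)).
  apply: measurable_funM => //.
  by apply: measurableT_comp (measurable_powR (-1)) _; exact: measurable_funX.
apply/funext => t; rewrite powR_inv1 ?sqr_ge0//.
have [->|ft0] := eqVneq (f t) 0; first by rewrite invr0 mul0r.
by field.
Qed.

Section borel_rV.
Context {R : realType} {N : nat}.

Lemma measurable_enorm d (T : measurableType d) (f : T -> 'rV[R]_N) :
  measurable_fun setT f -> measurable_fun setT (fun t => enorm (f t)).
Proof.
move=> mf.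
apply: (measurableT_comp (continuous_measurable_fun (@sqrt_continuous R))).
apply: measurable_sum => i.
by apply: measurable_funM; apply: measurableT_comp (measurable_coord i) mf.
Qed.

Lemma measurable_rVD d (T : measurableType d) (f g : T -> 'rV[R]_N) :
  measurable_fun setT f -> measurable_fun setT g ->
  measurable_fun setT (fun t => f t + g t).
Proof.
move=> mf mg; apply: measurable_fun_rV => i; under eq_fun do rewrite mxE.
by apply: measurable_funD; apply: measurableT_comp (measurable_coord i) _.
Qed.

Lemma measurable_rVZ d (T : measurableType d) (a : T -> R) (f : T -> 'rV[R]_N) :
  measurable_fun setT a -> measurable_fun setT f ->
  measurable_fun setT (fun t => a t *: f t).
Proof.
move=> ma mf; apply: measurable_fun_rV => i; under eq_fun do rewrite mxE.
by apply: measurable_funM => //; apply: measurableT_comp (measurable_coord i) _.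
Qed.

Lemma measurable_rVB d (T : measurableType d) (f g : T -> 'rV[R]_N) :
  measurable_fun setT f -> measurable_fun setT g ->
  measurable_fun setT (fun t => f t - g t).
Proof.
move=> mf mg; under eq_fun do rewrite -scaleN1r.
by apply: measurable_rVD => //; exact: measurable_rVZ.
Qed.

Lemma measurable_eball (x : 'rV[R]_N) e : measurable (eball x e).
Proof.
rewrite [X in measurable X](_ : _ = (fun y => enorm (y - x)) @^-1` `]-oo, e[%classic); last first.
  by apply/seteqP; split => y; rewrite /= in_itv.
rewrite -[X in measurable X]setTI; apply: measurable_enorm => //.
exact: measurable_rVB.
Qed.

(** The balls with a rational centre and a radius [1 / k.+1] form a countable
    basis of the topology. *)
Lemma measurable_open (U : set 'rV[R]_N) : open U -> measurable U.
Proof.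
move=> /openE_eball oU.
pose B (p : 'rV[rat]_N * nat) : set 'rV[R]_N := eball (map_mx ratr p.1) p.2.+1%:R^-1.
pose F p := if `[< B p `<=` U >] then B p else set0.
have -> : U = \bigcup_p F p.
  apply/seteqP; split => [x Ux|x [p _]]; last first.
    by rewrite /F; case: asboolP => // pU /pU.
  have [e e0 xU] := oU x Ux.
  pose k := Num.trunc (2 / e).
  have ke : 2 * k.+1%:R^-1 < e.
    by rewrite -ltr_pdivlMr ?invr_gt0// invrK mulrC -ltr_pdivrMr// truncnS_gt.
  have k0 : 0 < k.+1%:R^-1 :> R by rewrite invr_gt0.
  pose eta := k.+1%:R^-1 / N.+1%:R : R.
  have eta0 : 0 < eta by rewrite divr_gt0.
  have q_ i : exists q : rat, x ord0 i - eta < ratr q < x ord0 i + eta.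
    have [q] := @rat_in_itvoo R (x ord0 i - eta) (x ord0 i + eta) ltac:(lra).
    by rewrite in_itv/=; exists q.
  pose q : 'rV[rat]_N := \row_i projT1 (cid (q_ i)).
  have xq : enorm (x - map_mx ratr q) < k.+1%:R^-1.
    apply: (@le_lt_trans _ _ (N%:R * eta)).
      apply: enorm_le_coord => i; rewrite !mxE; case: cid => t /= ht.
      by rewrite ler_norml; lra.
    by rewrite mulrCA gtr_pMr// ltr_pdivrMr// mul1r ltr_nat.
  exists (q, k) => //; rewrite /F asboolT// => y qy.
  apply: xU; apply: le_lt_trans ke; rewrite mulr_natl mulr2n.
  rewrite (le_trans (enorm_triangle (map_mx ratr q) _ _))//.
  by rewrite lerD// ?(enormC _ x) ltW.
apply: countable_bigcupT_measurable => [|p]; first exact: countableP.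
rewrite /F.
by case: ifP => // _; exact: measurable_eball.
Qed.

End borel_rV.

(** * Lebesgue measure under affine maps *)

Section affine.
Context {R : realType}.
Local Notation leb := (@lebesgue_measure R).
Local Open Scope ereal_scope.

(** Lebesgue measure on the line is determined by its values on intervals, so
    the image measure only has to be computed there. The case [a < 0] provides
    the reflections. *)
Lemma ge0_integral_affine (a b : R) (f : R -> \bar R) : a != 0%R ->
  measurable_fun [set: measurableTypeR R] f -> (forall x, 0 <= f x) ->
  `|a|%:E * \int[leb]_x f (a * x + b)%R = \int[leb]_x f x.
Proof.
move=> a0 mf f0.
pose phi (x : measurableTypeR R) : measurableTypeR R := (a * x + b)%R.
have mphi : measurable_fun setT phi.
  by apply: measurable_funD => //; exact: measurable_funM.
pose phiM : {mfun measurableTypeR R >-> measurableTypeR R} :=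
  HB.pack phi (isMeasurableFun.Build _ _ _ _ _ mphi).
rewrite [RHS](@eq_measure_integral _ _ _ _ (mscale (NngNum (normr_ge0 a))
    (pushforward leb phiM))); last first.
  move=> A mA _; apply: lebesgue_measure_unique => // _ [[p q] _ <-] /=.
  rewrite /mscale/= /pushforward/=.
  have [agt0|agt0] : (0 < a \/ a < 0)%R by case: ltgtP a0; tauto.
  - rewrite [X in _ = _ * leb X](_ : _ = `](p - b) / a, (q - b) / a]%classic)%R; last first.
      apply/seteqP; split => x /=; rewrite !in_itv/= /phi;
      by rewrite ltr_pdivrMr// ler_pdivlMr// ltrBlDr lerBrDr mulrC.
    rewrite !lebesgue_measure_itv/= !lte_fin ltr_pM2r ?invr_gt0// ltrD2r.
    case: ifPn => pq; last by rewrite mule0.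
    by rewrite -!EFinB -EFinM gtr0_norm//; congr EFin; field.
  - rewrite [X in _ = _ * leb X](_ : _ = `[(q - b) / a, (p - b) / a[%classic)%R; last first.
      apply/seteqP; split => x /=; rewrite !in_itv/= /phi;
      by rewrite ltr_ndivlMr// ler_ndivrMr// ltrBlDr lerBrDr mulrC andbC.
    rewrite !lebesgue_measure_itv/= !lte_fin ltr_nM2r ?invr_lt0// ltrD2r.
    case: ifPn => pq; last by rewrite mule0.
    by rewrite -!EFinB -EFinM ltr0_norm//; congr EFin; field.
by rewrite ge0_integral_mscale// ge0_integral_pushforward.
Qed.

Lemma ge0_integral_lebesgue_rVS N (f : 'rV[R]_N.+1 -> \bar R) :
  measurable_fun setT f -> (forall x, 0 <= f x) ->
  \int[lebesgue_rV N.+1]_x f x =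
  \int[leb]_t \int[lebesgue_rV N]_v f (rV_cons (t, v)).
Proof.
move=> mf f0; pose c := @rV_cons R N.
rewrite [LHS](@ge0_integral_pushforward _ _ _ _ _ c (@measurable_rV_cons R N)
  (leb \x lebesgue_rV N))// preimage_setT.
rewrite fubini_tonelli1//.
  by apply: measurableT_comp => //; exact: measurable_rV_cons.
by move=> x /=; exact: f0.
Qed.

(** The measure being a product, each coordinate contributes one factor
    [`|a|]. *)
Lemma ge0_integral_rV_affine N (a : R) (v : 'rV[R]_N) (f : 'rV[R]_N -> \bar R) :
  a != 0%R -> measurable_fun setT f -> (forall x, 0 <= f x) ->
  (`|a| ^+ N)%:E * \int[lebesgue_rV N]_x f (a *: x + v)%R = \int[lebesgue_rV N]_x f x.
Proof.
move=> a0; elim: N v f => [|N IHN] v f mf f0.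
  rewrite expr0 mul1e; apply: eq_integral => x _; congr f.
  by apply/rowP => -[].
have mg : measurable_fun setT (fun x : 'rV[R]_N.+1 => f (a *: x + v)%R).
  by apply: measurableT_comp => //; apply: measurable_rVD => //; exact: measurable_rVZ.
rewrite !ge0_integral_lebesgue_rVS// exprS EFinM -muleA.
pose w : 'rV[R]_N := (\row_j v ord0 (lift ord0 j))%R.
have mfc t : measurable_fun setT (fun x => f (rV_cons (t, x))).
  apply: measurableT_comp => //.
  by apply: measurableT_comp (@measurable_rV_cons R N) _; exact: pair1_measurable.
pose F t := \int[lebesgue_rV N]_x f (rV_cons (t, x)).
have mF : measurable_fun setT F.
  apply: (measurable_fun_fubini_tonelli_F (f \o @rV_cons R N)).
    by apply: measurableT_comp => //; exact: measurable_rV_cons.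
  by move=> x /=; exact: f0.
have F0 t : 0 <= F t by exact: integral_ge0.
rewrite -[RHS](ge0_integral_affine (v ord0 ord0) a0 mF F0); congr (_ * _).
rewrite -ge0_integralZl//.
- apply: eq_integral => t _; rewrite /F -[RHS](IHN w _ (mfc _))//; congr (_ * _).
  apply: eq_integral => x _; congr f; apply/rowP => i; rewrite !mxE.
  by case: (unliftP ord0 i) => [j|] ->; rewrite /= ?liftK ?unlift_none ?mxE.
- apply: (measurable_fun_fubini_tonelli_F (fun p => f (a *: rV_cons p + v)%R)).
    by apply: (measurableT_comp mg); exact: measurable_rV_cons.
  by move=> x /=; exact: f0.
- by move=> t _; exact: integral_ge0.
Qed.

End affine.

(** * The inversion and its change of variables *)

Section inversion_geometry.
Context {R : realType} {N : nat}.
Variables (x0 : 'rV[R]_N) (r : R).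
Hypothesis r_gt0 : 0 < r.
Implicit Types (x y z : 'rV[R]_N) (U : set 'rV[R]_N).
Local Notation inv := (inversion x0 r).

Lemma inversionB x : inv x - x0 = (r ^+ 2 / enorm (x - x0) ^+ 2) *: (x - x0).
Proof. by rewrite addrC addKr. Qed.

Lemma inversion_center : inv x0 = x0.
Proof. by rewrite /inversion subrr scaler0 addr0. Qed.

Lemma enorm_inversionB x : enorm (inv x - x0) = r ^+ 2 / enorm (x - x0).
Proof.
have [->|xx0] := eqVneq x x0; first by rewrite inversion_center subrr enorm0 invr0 mulr0.
rewrite inversionB enormZ ger0_norm ?divr_ge0 ?sqr_ge0//.
have : 0 < enorm (x - x0) by rewrite enormB_gt0.
by move: (enorm _) => a a0; field; rewrite gt_eqF.
Qed.

Lemma inversionK : involutive inv.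
Proof.
move=> x; have [->|xx0] := eqVneq x x0; first by rewrite !inversion_center.
rewrite [LHS]/inversion enorm_inversionB inversionB scalerA.
have : 0 < enorm (x - x0) by rewrite enormB_gt0.
set a := enorm _ => a0; rewrite (_ : _ * _ = 1); first by rewrite scale1r subrKC.
by field; rewrite !gt_eqF.
Qed.

Lemma inversion_eq_center x : (inv x == x0) = (x == x0).
Proof.
apply/eqP/eqP => [xx0|->]; last exact: inversion_center.
by rewrite -[LHS]inversionK xx0 inversion_center.
Qed.

(** Expand both squares: the norms of [x - x0] and [z - x0] and their inner
    product determine the two sides. *)
Lemma enorm_inversion_sub x z : x != x0 -> z != x0 ->
  enorm (inv x - inv z) =
  r ^+ 2 * enorm (x - z) / (enorm (x - x0) * enorm (z - x0)).
Proof.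
rewrite -!enormB_gt0 => a0 b0.
have -> : inv x - inv z = (r ^+ 2 / enorm (x - x0) ^+ 2) *: (x - x0) +
    (- (r ^+ 2 / enorm (z - x0) ^+ 2)) *: (z - x0).
  by rewrite -inversionB scaleNr -inversionB opprB addrA subrK.
have -> : x - z = (x - x0) + (-1) *: (z - x0).
  by rewrite scaleN1r opprB addrA subrK.
move: (x - x0) (z - x0) a0 b0 => X Z a0 b0.
apply/eqP; rewrite -(@eqrXn2 _ 2)// ?enorm_ge0 ?divr_ge0 ?mulr_ge0 ?enorm_ge0 ?(ltW r_gt0)//.
rewrite expr_div_n [in eqbRHS]exprMn !sqr_enorm.
rewrite !(dotpDl, dotpDr, dotpZl, dotpZr) -!sqr_enorm (dotpC Z X).
move: (enorm X) (enorm Z) (dotp X Z) a0 b0 => a b c a0 b0.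
by apply/eqP; field; rewrite !gt_eqF.
Qed.

Lemma inversion_setE U : inversion_set x0 r U = inv @^-1` (U `\ x0).
Proof.
apply/seteqP; split => [_ [x Ux <-]|y Uy]; first by rewrite /= inversionK.
by exists (inv y) => //; rewrite inversionK.
Qed.

Lemma measurable_inversion : measurable_fun setT inv.
Proof.
apply: measurable_rVD => //; apply: measurable_rVZ; last exact: measurable_rVB.
apply: measurable_funM => //; apply: measurable_funV.
by apply: measurable_funX; apply: measurable_enorm; exact: measurable_rVB.
Qed.

End inversion_geometry.

Section inversion_change_of_variables.
Context {R : realType} {N : nat}.
Variables (x0 : 'rV[R]_N) (r : R).
Hypotheses (N_gt0 : (0 < N)%N) (r_gt0 : 0 < r).
Local Notation mu := (lebesgue_rV N).
Local Notation leb := (@lebesgue_measure R).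
Local Notation inv := (inversion x0 r).
Local Open Scope ereal_scope.

Lemma lebesgue_rV_set1 (x : 'rV[R]_N) : mu [set x] = 0.
Proof.
case: N N_gt0 x => // n _ x.
rewrite (_ : [set x] = [set v | forall i, [set x ord0 i] (v ord0 i)]); last first.
  by apply/seteqP; split => v /=; [move=> ->|move=> vx; apply/rowP].
rewrite (@lebesgue_rV_box _ _ (fun i => [set x ord0 i]))//.
by rewrite big_ord_recl lebesgue_measure_set1 mul0e.
Qed.

Lemma measurable_rV_set1 (x : 'rV[R]_N) : measurable [set x].
Proof.
rewrite (_ : [set x] = (fun y => enorm (y - x)) @^-1` [set 0%R]).
  rewrite -[X in measurable X]setTI; apply: measurable_enorm => //.
  exact: measurable_rVB.
apply/seteqP; split => y /=; first by move->; rewrite subrr enorm0.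
by move/eqP; rewrite enorm_eq0 subr_eq0 => /eqP.
Qed.

(** The function is averaged over each ray through [x0], with the Haar measure
    of the dilation group written additively: [t] acts by [expR t]. *)
Definition ray_integral (f : 'rV[R]_N -> \bar R) (w : 'rV[R]_N) : \bar R :=
  \int[leb]_t (f (x0 + expR t *: w)%R * (expR t ^+ N)%:E).

(** One period of the dilation by [expR 1]: each punctured ray through the
    origin meets this annulus in a set of Haar measure [1]. *)
Definition annulus : set 'rV[R]_N := [set w | 1 <= enorm w < expR 1]%R.

Lemma measurable_annulus : measurable annulus.
Proof.
rewrite (_ : annulus = enorm @^-1` `[1%R, expR 1[%classic).
  rewrite -[X in measurable X]setTI; exact: (@measurable_enorm _ _ _ _ id).
by apply/seteqP; split => w; rewrite /= in_itv.
Qed.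

Lemma integral_annulus (z : 'rV[R]_N) : z != 0%R ->
  \int[leb]_t (\1_annulus (expR (- t) *: z)%R)%:E = 1.
Proof.
rewrite -enorm_gt0 => z0.
rewrite (_ : (fun t => _) = EFin \o \1_`](ln (enorm z) - 1)%R, ln (enorm z)]%classic).
  rewrite integral_indic//= setIT lebesgue_measure_itv/= lte_fin gtrBl ltr01.
  by rewrite -EFinD opprB addrC subrK.
apply/funext => t /=; congr EFin; rewrite !indicE; congr ((_ : bool)%:R).
apply/idP/idP; rewrite !inE /annulus/= in_itv/= enormZ gtr0_norm ?expR_gt0//.
  rewrite expRN mulrC ler_pdivlMr ?expR_gt0// mul1r ltr_pdivrMr ?expR_gt0// -expRD.
  by rewrite -{1 2}[enorm z]lnK ?posrE// ler_expR ltr_expR => /andP[? ?]; lra.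
rewrite expRN mulrC ler_pdivlMr ?expR_gt0// mul1r ltr_pdivrMr ?expR_gt0// -expRD.
by rewrite -{3 4}[enorm z]lnK ?posrE// ler_expR ltr_expR => /andP[? ?]; lra.
Qed.

Lemma ae_neq (x : 'rV[R]_N) : {ae mu, forall y, y != x}.
Proof.
exists [set x]; split; [exact: measurable_rV_set1|exact: lebesgue_rV_set1|].
by move=> y /= /negP; rewrite negbK => /eqP.
Qed.

Lemma measurable_scale_expR d (T : measurableType d) (g : T -> R) (h : T -> 'rV[R]_N) :
  measurable_fun setT g -> measurable_fun setT h ->
  measurable_fun setT (fun p => expR (g p) *: h p)%R.
Proof. by move=> mg mh; apply: measurable_rVZ => //; exact: measurableT_comp. Qed.

Lemma measurable_ray (f : 'rV[R]_N -> \bar R) (w : 'rV[R]_N) :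
  measurable_fun setT f ->
  measurable_fun [set: measurableTypeR R]
    (fun t => f (x0 + expR t *: w)%R * (expR t ^+ N)%:E).
Proof.
move=> mf; apply: emeasurable_funM.
  apply: measurableT_comp => //; apply: measurable_rVD => //.
  exact: (@measurable_scale_expR _ _ id (cst w)).
by apply/measurable_EFinP; apply: measurable_funX; exact: measurable_expR.
Qed.

(** Each [x != x0] is given weight [1] by [integral_annulus], read as the time
    that the ray through [x] spends in the annulus; exchanging the two integrals
    and undoing the dilation by [expR t] leaves an average over rays. *)
Lemma integral_rays (f : 'rV[R]_N -> \bar R) :
  measurable_fun setT f -> (forall x, 0 <= f x) ->
  \int[mu]_w ((\1_annulus w)%:E * ray_integral f w) = \int[mu]_x f x.
Proof.
move=> mf f0.
have m1 : measurable_fun setT (\1_annulus : 'rV[R]_N -> R).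
  exact: measurable_indic measurable_annulus.
pose F (p : 'rV[R]_N * measurableTypeR R) :=
  (\1_annulus p.1)%:E * (f (x0 + expR p.2 *: p.1)%R * (expR p.2 ^+ N)%:E).
have F0 p : 0 <= F p by rewrite mule_ge0 ?mule_ge0 ?lee_fin// exprn_ge0// expR_ge0.
have mF : measurable_fun setT F.
  apply: emeasurable_funM; first by apply/measurable_EFinP; exact: measurableT_comp.
  apply: emeasurable_funM.
    apply: measurableT_comp => //; apply: measurable_rVD => //.
    exact: measurable_scale_expR.
  apply/measurable_EFinP; apply: measurable_funX.
  exact: measurableT_comp.
pose G (p : 'rV[R]_N * measurableTypeR R) :=
  (\1_annulus (expR (- p.2) *: (p.1 - x0))%R)%:E * f p.1.
have G0 p : 0 <= G p by rewrite mule_ge0 ?lee_fin.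
have mG : measurable_fun setT G.
  apply: emeasurable_funM; last exact: measurableT_comp.
  apply/measurable_EFinP; apply: measurableT_comp => //.
  apply: measurable_scale_expR; last exact: measurable_rVB.
  exact: measurableT_comp.
transitivity (\int[mu]_w \int[leb]_t F (w, t)).
  apply: eq_integral => w _; rewrite -ge0_integralZl//; first exact: measurable_ray.
  by move=> t _; rewrite mule_ge0// lee_fin exprn_ge0// expR_ge0.
rewrite fubini_tonelli//.
transitivity (\int[leb]_t \int[mu]_x G (x, t)).
  apply: eq_integral => t _.
  rewrite -(@ge0_integral_rV_affine _ _ (expR t) x0)//=; last 2 first.
  - by rewrite gt_eqF// expR_gt0.
  - exact: measurableT_comp.
  rewrite gtr0_norm ?expR_gt0// -ge0_integralZl//; last first.
  - apply: (measurableT_comp mG); apply: measurable_fun_pair => //.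
    by apply: measurable_rVD => //; exact: measurable_rVZ.
  apply: eq_integral => w _; rewrite /F /G/= addrK scalerA -expRD addNr expR0 scale1r.
  by rewrite [in RHS]muleCA [(_ + x0)%R]addrC [X in _ = _ * X]muleC.
rewrite -fubini_tonelli//; apply: ge0_ae_eq_integral => //.
- exact: measurable_fun_fubini_tonelli_F.
- by move=> x _; exact: integral_ge0.
apply: filterS (ae_neq x0) => x xx0 _; rewrite /G/= ge0_integralZr//=.
  by rewrite integral_annulus ?mul1e// subr_eq0.
apply/measurable_EFinP; apply: (measurableT_comp m1).
apply: (@measurable_scale_expR _ (measurableTypeR R) (fun t => - t)%R (cst (x - x0)%R)) => //.
exact: measurable_funN.
Qed.

Definition inversion_jacobian (z : 'rV[R]_N) : R :=
  ((r / enorm (z - x0)) ^+ (2 * N))%R.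
Local Notation J := inversion_jacobian.

Lemma inversion_jacobian_ge0 z : (0 <= J z)%R.
Proof. by rewrite exprn_ge0// divr_ge0 ?enorm_ge0 ?ltW. Qed.

Lemma measurable_inversion_jacobian : measurable_fun setT J.
Proof.
apply: measurable_funX; apply: measurable_funM => //; apply: measurable_funV.
by apply: measurable_enorm; exact: measurable_rVB.
Qed.

(** On the ray through [x0 + w] the inversion is the reflection
    [t |-> c - t] of the additive parameter, which the one-dimensional Lebesgue
    measure does not see. *)
Lemma ray_integral_inversion (f : 'rV[R]_N -> \bar R) (w : 'rV[R]_N) :
  measurable_fun setT f -> (forall x, 0 <= f x) -> w != 0%R ->
  ray_integral (fun z => f (inv z) * (J z)%:E) w = ray_integral f w.
Proof.
rewrite -enorm_gt0 => mf f0 w0.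
rewrite [RHS]/ray_integral.
rewrite -(@ge0_integral_affine _ (-1) (ln (r ^+ 2 / enorm w ^+ 2)))//=; last 2 first.
- exact: measurable_ray.
- by move=> t; rewrite mule_ge0// lee_fin exprn_ge0// expR_ge0.
rewrite normrN1 mul1e; apply: eq_integral => t _.
rewrite mulN1r expRD expRN lnK ?posrE ?divr_gt0 ?exprn_gt0//.
rewrite /inversion /J [(x0 + _ - x0)%R]addrC addKr enormZ (gtr0_norm (expR_gt0 _)).
have := expR_gt0 t; move: (expR t) (enorm w) w0 => e n n0 e0.
rewrite -muleA -EFinM exprM -exprMn scalerA.
by congr (f (_ + _ *: _)%R * (_ ^+ _)%:E); field; rewrite !gt_eqF.
Qed.

(** Change of variables for the inversion: the averages over the punctured rays
    determine the integral, and the inversion preserves each of them. *)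
Theorem ge0_integral_inversion (f : 'rV[R]_N -> \bar R) :
  measurable_fun setT f -> (forall x, 0 <= f x) ->
  \int[mu]_z (f (inv z) * (J z)%:E) = \int[mu]_y f y.
Proof.
move=> mf f0; rewrite -integral_rays; first last.
- by move=> z; rewrite mule_ge0// lee_fin inversion_jacobian_ge0.
- apply: emeasurable_funM; first exact: (measurableT_comp mf (measurable_inversion _ _)).
  apply/measurable_EFinP; exact: measurable_inversion_jacobian.
rewrite -[RHS]integral_rays//; apply: eq_integral => w _.
rewrite indicE; case: (boolP (w \in annulus)); last by rewrite !mul0e.
rewrite inE => /andP[w1 _]; rewrite ray_integral_inversion//.
by rewrite -enorm_gt0 (lt_le_trans _ w1).
Qed.

End inversion_change_of_variables.

(** * Integrals over inverted sets *)

Section integral_complements.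
Context d (T : measurableType d) {R : realType}.
Variable mu : {measure set T -> \bar R}.
Implicit Types (A B D : set T).

Lemma integrable_setU_disj A B (f : T -> \bar R) : measurable A -> measurable B ->
  [disjoint A & B] ->
  mu.-integrable A f -> mu.-integrable B f -> mu.-integrable (A `|` B) f.
Proof.
move=> mA mB AB /integrableP[mfA fA] /integrableP[mfB fB].
have mf : measurable_fun (A `|` B) f by apply/measurable_funU.
apply/integrableP; split=> //; rewrite ge0_integral_setU//; last exact: measurableT_comp.
exact: lte_add_pinfty.
Qed.

Lemma integrable_le D (f g : T -> R) : measurable D ->
  measurable_fun setT f -> (forall x, D x -> `|f x| <= g x) ->
  mu.-integrable D (EFin \o g) -> mu.-integrable D (EFin \o f).
Proof.
move=> mD mf fg; apply: le_integrable => //.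
  by apply/measurable_EFinP; exact: measurable_funS mf.
by move=> x Dx /=; rewrite lee_fin (le_trans (fg _ Dx))// ler_norm.
Qed.

Lemma integrable_bounded D (f : T -> R) M : measurable D -> (mu D < +oo)%E ->
  measurable_fun setT f -> (forall x, D x -> `|f x| <= M) ->
  mu.-integrable D (EFin \o f).
Proof.
move=> mD Doo mf fM; apply: (integrable_le (g := cst M)) => //.
apply: measurable_bounded_integrable => //.
exists `|M|; split; first by rewrite num_real.
by move=> K MK x _ /=; exact: ltW.
Qed.

End integral_complements.

Section inversion_integrals.
Context {R : realType} {N : nat}.
Variables (x0 : 'rV[R]_N) (r : R).
Hypotheses (N_gt0 : (0 < N)%N) (r_gt0 : 0 < r).
Local Notation mu := (lebesgue_rV N).
Local Notation inv := (inversion x0 r).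
Local Notation J := (inversion_jacobian x0 r).

Lemma measurable_inversion_preimage D : measurable D -> measurable (inv @^-1` D).
Proof. by move=> mD; rewrite -[X in measurable X]setTI; exact: measurable_inversion. Qed.

Lemma ge0_integral_inversion_set D (f : 'rV[R]_N -> \bar R) : measurable D ->
  measurable_fun setT f -> (forall x, 0 <= f x)%E ->
  (\int[mu]_(y in inv @^-1` D) f y = \int[mu]_(z in D) (f (inv z) * (J z)%:E))%E.
Proof.
move=> mD mf f0; rewrite integral_mkcond [RHS]integral_mkcond.
rewrite -(@ge0_integral_inversion _ _ x0 r)//.
- apply: eq_integral => z _; rewrite !patchE.
  rewrite (_ : (inv z \in inv @^-1` D) = (z \in D)).
    by case: ifP => // _; rewrite mul0e.
  by apply/idP/idP; rewrite !inE /= inversionK.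
- apply/(measurable_restrictT _ _).1; first exact: measurable_inversion_preimage.
  exact: measurable_funS mf.
- by move=> x; rewrite patchE; case: ifP.
Qed.

(** The Jacobian being nonnegative, the positive and negative parts of both
    sides agree; so do the default values when the integrals diverge. *)
Lemma Rintegral_inversion D (g : 'rV[R]_N -> R) : measurable D ->
  measurable_fun setT g ->
  \int[mu]_(y in inv @^-1` D) g y = \int[mu]_(z in D) (g (inv z) * J z).
Proof.
move=> mD mg; rewrite /Rintegral integralE [in RHS]integralE.
have mg' : measurable_fun setT (EFin \o g) by exact/measurable_EFinP.
rewrite !ge0_integral_inversion_set//; last 2 first.
- exact: measurable_funeneg.
- exact: measurable_funepos.
congr (fine (_ - _)); apply: eq_integral => z _; rewrite !(funeposE, funenegE)/=.
- by rewrite -!EFin_max -EFinM maxr_pMl ?mul0r// inversion_jacobian_ge0.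
- by rewrite -!EFin_max -EFinM maxr_pMl ?mul0r ?mulNr// inversion_jacobian_ge0.
Qed.

Lemma integrable_inversion D (g : 'rV[R]_N -> R) : measurable D ->
  measurable_fun setT g ->
  mu.-integrable (inv @^-1` D) (EFin \o g) <->
  mu.-integrable D (EFin \o (fun z => g (inv z) * J z)).
Proof.
move=> mD mg.
have E : (\int[mu]_(y in inv @^-1` D) `|(g y)%:E| =
          \int[mu]_(z in D) `|(g (inv z) * J z)%:E|)%E.
  rewrite ge0_integral_inversion_set//; last exact/measurable_EFinP/measurableT_comp.
  apply: eq_integral => z _ /=.
  by rewrite -EFinM normrM (ger0_norm (inversion_jacobian_ge0 _ _ _)).
have mgJ : measurable_fun setT (fun z => g (inv z) * J z).
  apply: measurable_funM; last exact: measurable_inversion_jacobian.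
  exact: (measurableT_comp mg (measurable_inversion _ _)).
split => /integrableP[_ gi]; apply/integrableP; split.
- by apply/measurable_EFinP; exact: measurable_funS mgJ.
- by rewrite -E.
- by apply/measurable_EFinP; exact: measurable_funS mg.
- by rewrite E.
Qed.

End inversion_integrals.

(** * The logarithmic Laplacian as an integral over the support *)

Section log_laplacian_decomposition.
Context {R : realType} {N : nat}.
Local Notation mu := (lebesgue_rV N).
Implicit Types (x y : 'rV[R]_N) (u : 'rV[R]_N -> R) (U : set 'rV[R]_N).

Definition diff_quotient u x y : R := (u x - u y) / enorm (x - y) ^+ N.

Lemma measurable_div_enorm u x : measurable_fun setT u ->
  measurable_fun setT (fun y => u y / enorm (x - y) ^+ N).
Proof.
move=> mfu; apply: measurable_funM => //; apply: measurable_funV.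
by apply: measurable_funX; apply: measurable_enorm; exact: measurable_rVB.
Qed.

Lemma measurable_enormVn x :
  measurable_fun setT (fun y : 'rV[R]_N => enorm (x - y) ^- N).
Proof.
under eq_fun do rewrite -div1r; exact: (@measurable_div_enorm (cst 1)).
Qed.

Lemma measurable_diff_quotient u x : measurable_fun setT u ->
  measurable_fun setT (diff_quotient u x).
Proof.
by move=> mfu; apply: (@measurable_div_enorm (fun y => u x - u y)); exact: measurable_funB.
Qed.

Section decomposition.
Variables (U : set 'rV[R]_N) (u : 'rV[R]_N -> R) (x : 'rV[R]_N).
Hypothesis mU : measurable U.
Hypotheses (u_out : forall y, ~ U y -> u y = 0) (hU : u x != 0 -> h_defined U x).
Local Notation B := (eball x 1).
Local Notation k := (fun y => enorm (x - y) ^- N).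

Let mB : measurable B. Proof. exact: measurable_eball. Qed.

Let integrable_cst_kernel (D : set 'rV[R]_N) : measurable D ->
  (u x != 0 -> mu.-integrable D (EFin \o k)) ->
  mu.-integrable D (EFin \o (fun y => u x * k y)).
Proof.
have [ux0|ux0] := eqVneq (u x) 0; last first.
  by move=> mD /(_ isT) ik; exact: (integrableZl mD (u x) ik).
move=> mD _; apply: eq_integrable (integrable0 _ _) => // y _ /=.
by rewrite ux0 mul0r.
Qed.

Let Rintegral_cst_kernel (D : set 'rV[R]_N) : measurable D ->
  (u x != 0 -> mu.-integrable D (EFin \o k)) ->
  \int[mu]_(y in D) (u x * k y) = u x * \int[mu]_(y in D) k y.
Proof.
have [ux0|ux0] := eqVneq (u x) 0; last by move=> mD /(_ isT); exact: RintegralZl.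
move=> mD _; rewrite ux0 mul0r -[RHS](mul0r (fine (mu D))) -Rintegral_cst//.
by apply: eq_Rintegral => y _; rewrite mul0r.
Qed.

Let integrable_out : mu.-integrable (B `\` U) (EFin \o (fun y => u x * k y)).
Proof. by apply: integrable_cst_kernel => [|/hU[]//]; exact: measurableD. Qed.

Let integrable_in : mu.-integrable (U `\` B) (EFin \o (fun y => u x * k y)).
Proof. by apply: integrable_cst_kernel => [|/hU[]//]; exact: measurableD. Qed.

Let diff_quotient_out y : ~ U y -> diff_quotient u x y = u x * k y.
Proof. by move=> /u_out uy0; rewrite /diff_quotient uy0 subr0. Qed.

Let diff_quotientE y : diff_quotient u x y = u x * k y - u y / enorm (x - y) ^+ N.
Proof. exact: mulrBl. Qed.

(** Off [U] the quotient is [u x] times the kernel. So the two domains of the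
    definition of [loglap] can be traded for [U], at the price of [u x] times the
    two integrals of [h_]; this is why their convergence is asked only when
    [u x != 0]. *)
Lemma loglap_definedP :
  loglap_defined u x <-> mu.-integrable U (EFin \o diff_quotient u x).
Proof.
split=> [[iB iCB]|iU].
  rewrite -(setUIDK U B); apply: integrable_setU_disj.
  - exact: measurableI.
  - exact: measurableD.
  - by apply/disj_setPS => y [[_ ?] []].
  - by apply: integrableS iB => //; exact: measurableI.
  - apply: (@eq_integrable _ _ _ _ _ _ ((fun y => (u x * k y)%:E) \-
        (fun y => (u y / enorm (x - y) ^+ N)%:E))%E).
    + exact: measurableD.
    + by move=> y _; rewrite /= diff_quotientE.
    + apply: integrableB => //; first exact: measurableD.
      by apply: integrableS iCB => //; [exact: measurableC|exact: measurableD].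
split.
  rewrite -(setUIDK B U); apply: integrable_setU_disj.
  - exact: measurableI.
  - exact: measurableD.
  - by apply/disj_setPS => y [[_ ?] []].
  - by apply: integrableS iU => //; exact: measurableI.
  - apply: eq_integrable integrable_out; first exact: measurableD.
    by move=> y; rewrite inE => -[_ /diff_quotient_out]; rewrite /= /diff_quotient => ->.
rewrite -(setUIDK (~` B) U); apply: integrable_setU_disj.
- by apply: measurableI => //; exact: measurableC.
- by apply: measurableD => //; exact: measurableC.
- by apply/disj_setPS => y [[_ ?] []].
- rewrite setIC -setDE; apply: (@eq_integrable _ _ _ _ _ _ ((fun y => (u x * k y)%:E) \-
        (EFin \o diff_quotient u x))%E).
  + exact: measurableD.
  + by move=> y _; rewrite /= -EFinB diff_quotientE subKr.
  + apply: integrableB => //; first exact: measurableD.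
    by apply: integrableS iU => //; exact: measurableD.
- apply: eq_integrable (integrable0 _ _) => //.
    by apply: measurableD => //; exact: measurableC.
  by move=> y; rewrite inE => -[_ /u_out] /= ->; rewrite mul0r.
Qed.

Lemma loglapE : loglap_defined u x ->
  loglap u x = c_ N * \int[mu]_(y in U) diff_quotient u x y
               + (rho_ N + h_ U x) * u x.
Proof.
move=> lu; have [iB iCB] := lu; have /loglap_definedP iU := lu.
have iUI : mu.-integrable (U `&` B) (EFin \o diff_quotient u x).
  by apply: integrableS iU => //; exact: measurableI.
have iUD : mu.-integrable (U `\` B) (EFin \o diff_quotient u x).
  by apply: integrableS iU => //; exact: measurableD.
have EU : \int[mu]_(y in U) diff_quotient u x y =
    \int[mu]_(y in U `&` B) diff_quotient u x y +
    \int[mu]_(y in U `\` B) diff_quotient u x y.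
  rewrite -{1}(setUIDK U B) Rintegral_setU ?setUIDK//.
  - exact: measurableI.
  - exact: measurableD.
  - by apply/disj_setPS => y [[_ ?] []].
have EB : \int[mu]_(y in B) ((u x - u y) / enorm (x - y) ^+ N) =
    \int[mu]_(y in U `&` B) diff_quotient u x y +
    u x * \int[mu]_(y in B `\` U) k y.
  rewrite -{1}(setUIDK B U) Rintegral_setU ?setUIDK//; last 3 first.
  - exact: measurableI.
  - exact: measurableD.
  - by apply/disj_setPS => y [[_ ?] []].
  rewrite setIC; congr (_ + _); rewrite -Rintegral_cst_kernel.
  - apply: eq_Rintegral => y; rewrite inE => -[_] /diff_quotient_out.
    by rewrite /diff_quotient => ->.
  - exact: measurableD.
  - by move=> /hU[].
have ECB : \int[mu]_(y in ~` B) (u y / enorm (x - y) ^+ N) =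
    u x * \int[mu]_(y in U `\` B) k y -
    \int[mu]_(y in U `\` B) diff_quotient u x y.
  rewrite -{1}(setUIDK (~` B) U) Rintegral_setU ?setUIDK//; last 3 first.
  - by apply: measurableI => //; exact: measurableC.
  - by apply: measurableD => //; exact: measurableC.
  - by apply/disj_setPS => y [[_ ?] []].
  rewrite [X in _ + X = _](_ : _ = 0); last first.
    transitivity (\int[mu]_(y in ~` B `\` U) 0 : R).
      by apply: eq_Rintegral => y; rewrite inE => -[_ /u_out ->]; rewrite mul0r.
    by rewrite /Rintegral integral0.
  rewrite addr0 setIC -setDE -Rintegral_cst_kernel; last 2 first.
  - exact: measurableD.
  - by move=> /hU[].
  rewrite -RintegralB//; last exact: measurableD.
  by apply: eq_Rintegral => y _; rewrite diff_quotientE subKr.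
rewrite /loglap EB ECB EU /h_; ring.
Qed.

End decomposition.

End log_laplacian_decomposition.

(** * The transformation formula *)

Section kelvin_log_laplacian.
Context {R : realType} {N : nat}.
Variables (x0 : 'rV[R]_N) (r : R).
Hypotheses (N_gt0 : (0 < N)%N) (r_gt0 : 0 < r).
Local Notation mu := (lebesgue_rV N).
Local Notation inv := (inversion x0 r).
Local Notation J := (inversion_jacobian x0 r).
Implicit Types (x y z : 'rV[R]_N) (u : 'rV[R]_N -> R) (U : set 'rV[R]_N).

Lemma kelvin_inversion u x :
  kelvin x0 r u (inv x) = enorm (inv x - x0) ^- N * u x.
Proof. by rewrite /kelvin inversionK. Qed.

Lemma measurable_kelvin u : measurable_fun setT u ->
  measurable_fun setT (kelvin x0 r u).
Proof.
move=> mfu; apply: measurable_funM.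
  by under eq_fun do rewrite enormC; exact: measurable_enormVn.
exact: (measurableT_comp mfu (measurable_inversion _ _)).
Qed.

Lemma kelvin_center u : kelvin x0 r u x0 = 0.
Proof. by rewrite /kelvin subrr enorm0 expr0n gtn_eqF// invr0 mul0r. Qed.

Lemma kelvin_out U u : (forall y, ~ U y -> u y = 0) ->
  forall y, ~ inversion_set x0 r U y -> kelvin x0 r u y = 0.
Proof.
move=> u_out y; have [->|yx0] := eqVneq y x0; first by rewrite kelvin_center.
rewrite inversion_setE// /kelvin => nUy; rewrite u_out ?mulr0// => Uy.
by apply: nUy; split => //=; apply/eqP; rewrite inversion_eq_center.
Qed.

Lemma measurable_inversion_set U : measurable U -> measurable (inversion_set x0 r U).
Proof.
move=> mU; rewrite inversion_setE//; apply: measurable_inversion_preimage.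
by apply: measurableD => //; exact: measurable_rV_set1.
Qed.

Lemma measurable_kelvin_kernel x : measurable_fun setT (kelvin_kernel x0 x).
Proof.
rewrite (_ : kelvin_kernel x0 x = fun z =>
    (enorm (z - x0) ^- N - enorm (x - x0) ^- N) / enorm (x - z) ^+ N); last first.
  by apply/funext => z; rewrite /kelvin_kernel (enormC z x).
apply: (@measurable_div_enorm _ _ (fun z => enorm (z - x0) ^- N - _)).
apply: measurable_funB => //.
by under eq_fun do rewrite enormC; exact: measurable_enormVn.
Qed.

(** Each of the factors [inv], Jacobian and conformal weight contributes a power
    of the distances to [x0]; what they do not cancel is the kernel
    [kelvin_kernel]. *)
Lemma diff_quotient_kelvin u x z : x != x0 -> z != x0 ->
  diff_quotient (kelvin x0 r u) (inv x) (inv z) * J z =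
  enorm (inv x - x0) ^- N * diff_quotient u x z +
  r ^+ (2 * N) * enorm (inv x - x0) ^- (2 * N) * u x * kelvin_kernel x0 x z.
Proof.
move=> xx0 zx0; rewrite /diff_quotient /kelvin_kernel !kelvin_inversion.
have [->|xz] := eqVneq x z.
  by rewrite !subrr enorm0 expr0n gtn_eqF// invr0 !(mulr0, mul0r) addr0.
rewrite enorm_inversion_sub// !enorm_inversionB// (enormC z x) /inversion_jacobian.
rewrite !(mulnC 2%N) !exprM !(expr_div_n, exprMn).
have : 0 < enorm (x - x0) ^+ N by rewrite exprn_gt0// enormB_gt0.
have : 0 < enorm (z - x0) ^+ N by rewrite exprn_gt0// enormB_gt0.
have : 0 < enorm (x - z) ^+ N by rewrite exprn_gt0// enormB_gt0.
have : 0 < r ^+ N by rewrite exprn_gt0.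
move: (enorm (x - x0) ^+ N) (enorm (z - x0) ^+ N) (enorm (x - z) ^+ N) (r ^+ N).
move=> a b e s s0 e0 b0 a0.
by field; rewrite !gt_eqF.
Qed.

Lemma Rintegral_setD1 U (g : 'rV[R]_N -> R) : measurable U ->
  mu.-integrable U (EFin \o g) ->
  \int[mu]_(z in U `\ x0) g z = \int[mu]_(z in U) g z.
Proof.
move=> mU ig; rewrite /Rintegral; congr fine; symmetry.
apply: negligible_integral => //; [exact: measurable_rV_set1|exact: lebesgue_rV_set1].
Qed.

(** By [loglapE] both sides are integrals of difference quotients, over [U] and
    over its image, plus multiples of [u x]. The inversion maps one domain to
    the other and [diff_quotient_kelvin] compares the integrands. *)
Theorem kelvin_loglap U u x : measurable U -> measurable_fun setT u ->
  (forall y, ~ U y -> u y = 0) -> x != x0 ->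
  (u x != 0 -> [/\ h_defined U x, h_defined (inversion_set x0 r U) (inv x) &
     mu.-integrable U (EFin \o kelvin_kernel x0 x)]) ->
  loglap_defined u x ->
  loglap_defined (kelvin x0 r u) (inv x) /\
  loglap (kelvin x0 r u) (inv x) =
    enorm (inv x - x0) ^- N * loglap u x
    + c_ N * r ^+ (2 * N) * enorm (inv x - x0) ^- (2 * N) * u x *
      \int[mu]_(z in U) kelvin_kernel x0 x z
    + (h_ (inversion_set x0 r U) (inv x) - h_ U x) * enorm (inv x - x0) ^- N * u x.
Proof.
move=> mU mfu u_out xx0 hx lu.
set us := kelvin x0 r u; set Us := inversion_set x0 r U.
set al := enorm (inv x - x0) ^- N.
set be := r ^+ (2 * N) * enorm (inv x - x0) ^- (2 * N) * u x.
have mUs : measurable Us by exact: measurable_inversion_set.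
have mus : measurable_fun setT us by exact: measurable_kelvin.
have us_out : forall y, ~ Us y -> us y = 0 by exact: kelvin_out.
have usx : us (inv x) = al * u x by exact: kelvin_inversion.
have hU : u x != 0 -> h_defined U x by move=> /hx[].
have hUs : us (inv x) != 0 -> h_defined Us (inv x).
  by rewrite usx mulf_eq0 negb_or => /andP[_ /hx[]].
have mU0 : measurable (U `\ x0).
  by apply: measurableD => //; exact: measurable_rV_set1.
have iU : mu.-integrable U (EFin \o diff_quotient u x).
  exact: (loglap_definedP mU u_out hU).1.
have iK : mu.-integrable U (EFin \o (fun z => be * kelvin_kernel x0 x z)).
  have [ux0|/hx[_ _ ik]] := eqVneq (u x) 0.
    apply: eq_integrable (integrable0 _ _) => // z _ /=.
    by rewrite /be ux0 mulr0 mul0r.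
  exact: (integrableZl mU be ik).
have iA : mu.-integrable U (EFin \o (fun z => al * diff_quotient u x z)).
  exact: (integrableZl mU al iU).
have iS : mu.-integrable U
    (EFin \o (fun z => al * diff_quotient u x z + be * kelvin_kernel x0 x z)).
  exact: (integrableD mU iA iK).
have E z : (U `\ x0) z -> diff_quotient us (inv x) (inv z) * J z =
    al * diff_quotient u x z + be * kelvin_kernel x0 x z.
  by move=> [_ /eqP zx0]; exact: diff_quotient_kelvin.
have mdq : measurable_fun setT (diff_quotient us (inv x)).
  exact: measurable_diff_quotient.
have lus : loglap_defined us (inv x).
  apply/(loglap_definedP mUs us_out hUs); rewrite /Us inversion_setE//.
  apply/integrable_inversion => //.
  apply: (@eq_integrable _ _ _ _ _ mU0 (EFin \o (fun z =>
    al * diff_quotient u x z + be * kelvin_kernel x0 x z))).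
    by move=> z; rewrite inE => Uz; rewrite /= E.
  by apply: integrableS iS => //; exact: subDsetl.
split => //.
rewrite (loglapE mUs us_out hUs lus) (loglapE mU u_out hU lu).
have -> : \int[mu]_(y in Us) diff_quotient us (inv x) y =
    al * \int[mu]_(z in U) diff_quotient u x z +
    be * \int[mu]_(z in U) kelvin_kernel x0 x z.
  rewrite /Us inversion_setE// Rintegral_inversion//.
  transitivity (\int[mu]_(z in U `\ x0)
     (al * diff_quotient u x z + be * kelvin_kernel x0 x z)).
    by apply: eq_Rintegral => z; rewrite inE => /E.
  rewrite Rintegral_setD1// RintegralD//; congr (_ + _); first exact: RintegralZl.
  have [ux0|/hx[_ _ ik]] := eqVneq (u x) 0; last exact: RintegralZl.
  rewrite {2}/be ux0 mulr0 mul0r -[RHS](mul0r (fine (mu U))) -Rintegral_cst//.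
  by apply: eq_Rintegral => y _; rewrite /be ux0 mulr0 mul0r.
rewrite usx -/al /be; ring.
Qed.

End kelvin_log_laplacian.

(** * Radial singular integrals *)

Lemma nondecreasing_emeasurable {R : realType} (D : set R) (f : R -> \bar R) :
  measurable D -> {homo f : s t / (s <= t)%R >-> (s <= t)%E} -> measurable_fun D f.
Proof.
move=> mD f_nd; apply: (measurability _ (ErealGenCInfty.measurableE R)).
move=> /= _ [_ [a ->]] <-; apply: measurableI => //.
apply: is_interval_measurable => s t/=.
rewrite !in_itv/= !andbT => fs ft z /andP[sz zt].
by rewrite in_itv/= andbT (le_trans fs)// f_nd.
Qed.

Section volume_of_balls.
Context {R : realType} {N : nat}.
Local Notation mu := (lebesgue_rV N).
Implicit Types (x : 'rV[R]_N).

Lemma lebesgue_eball_lty x s : (mu (eball x s) < +oo)%E.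
Proof.
pose A (i : 'I_N) : set R := `[x ord0 i - s, x ord0 i + s]%classic.
have mA i : measurable (A i) by exact: measurable_itv.
apply: (@le_lt_trans _ _ (mu [set v | forall i, A i (v ord0 i)])).
  apply: le_measure; rewrite ?inE.
  - exact: measurable_eball.
  - rewrite [X in measurable X](_ : _ = \bigcap_i [set v : 'rV[R]_N | A i (v ord0 i)]).
      apply: fin_bigcap_measurable => // i _.
      by rewrite -[X in measurable X]setTI; exact: measurable_coord.
    by apply/seteqP; split => [v Av i _|v Av i]; exact: Av.
  - move=> y xy i; rewrite /A/= in_itv/=.
    have := le_lt_trans (coord_le_enorm (y - x) i) xy.
    by rewrite !mxE ltr_norml => /andP[? ?]; apply/andP; split; lra.
rewrite lebesgue_rV_box//.
rewrite (eq_bigr (fun i => (fine (lebesgue_measure (A i)))%:E)).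
  by rewrite prodEFin ltry.
move=> i _; rewrite fineK// lebesgue_measure_itv/=; case: ifP => //.
Qed.

Definition unit_ball_volume : R := fine (mu (eball (0 : 'rV[R]_N) 1)).

Lemma unit_ball_volume_ge0 : 0 <= unit_ball_volume.
Proof. exact: fine_ge0. Qed.

Lemma lebesgue_eball x s : 0 < s -> mu (eball x s) = (s ^+ N * unit_ball_volume)%:E.
Proof.
move=> s0; have me y e : measurable (eball y e : set 'rV[R]_N) by exact: measurable_eball.
rewrite EFinM fineK ?ge0_fin_numE ?lebesgue_eball_lty//.
rewrite -[LHS]/(mu (eball x s)) -(setIT (eball x s)) -(setIT (eball 0 1)).
rewrite -!integral_indic//.
rewrite -(@ge0_integral_rV_affine _ _ s x)//; last 2 first.
- by rewrite gt_eqF.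
- by apply/measurable_EFinP; exact: measurable_indic.
rewrite gtr0_norm//; congr (_ * _)%E; apply: eq_integral => y _.
congr EFin; rewrite !indicE; congr ((_ : bool)%:R).
apply/idP/idP; rewrite !inE /eball/= addrK subr0 enormZ gtr0_norm//.
  by rewrite gtr_pMr.
by rewrite gtr_pMr.
Qed.

End volume_of_balls.

Section radial_kernel.
Context {R : realType} {N : nat}.
Hypothesis N_gt0 : (0 < N)%N.
Local Notation mu := (lebesgue_rV N).
Local Notation leb := (@lebesgue_measure R).
Local Notation V := (unit_ball_volume (R := R) (N := N)).
Implicit Types (x y z : 'rV[R]_N).

(** A shell decomposition without sums: [w rho * rho ^- N] is at most the
    integral of [s |-> w s * s ^- N.+1] over [rho, 2 rho], up to a constant, and
    by Tonelli the points [z] with [s] in that range for [rho = enorm (z - x)]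
    lie in a ball of radius [2 s]. *)
Lemma integral_radial_le x (w : R -> \bar R) :
  {homo w : s t / (s <= t)%R >-> (s <= t)%E} -> (forall s, 0 <= w s)%E ->
  (\int[mu]_(z in eball x 2^-1) (w (enorm (z - x)) * (enorm (z - x) ^- N)%:E) <=
   (2 ^+ N.+1 * (2 ^+ N * V))%:E * \int[leb]_(s in `]0%R, 1%R[) (w s * (s^-1)%:E))%E.
Proof.
move=> w_nd w0; set B := eball x 2^-1.
have mB : measurable B by exact: measurable_eball.
pose rho z := enorm (z - x).
have rho0 z : 0 <= rho z by exact: enorm_ge0.
have mrho d (T : measurableType d) (f : T -> 'rV[R]_N) : measurable_fun setT f ->
    measurable_fun setT (fun p => rho (f p)).
  by move=> mf; apply: measurable_enorm; exact: measurable_rVB.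
have mw : measurable_fun [set: measurableTypeR R] w by exact: nondecreasing_emeasurable.
pose E : set ('rV[R]_N * measurableTypeR R) :=
  [set p | rho p.1 <= p.2] `&` [set p | p.2 <= 2 * rho p.1].
have mE : measurable E.
  apply: measurableI; rewrite -[X in measurable X]setTI; apply: measurable_fun_le => //.
  - exact: mrho.
  - by apply: measurable_funM => //; exact: mrho.
pose I : set (measurableTypeR R) := `]0, 1[%classic.
have mI : measurable I by exact: measurable_itv.
pose g (s : measurableTypeR R) := (w s * (s ^- N.+1)%:E)%E.
have mg : measurable_fun [set: measurableTypeR R] g.
  apply: emeasurable_funM => //; apply/measurable_EFinP; apply: measurable_funV.
  exact: measurable_funX.
have g0 s : I s -> (0 <= g s)%E.
  by rewrite /I/= in_itv/= => /andP[s0 _]; rewrite mule_ge0// lee_fin invr_ge0 exprn_ge0// ltW.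
pose F (p : 'rV[R]_N * measurableTypeR R) : \bar R := ((\1_E p)%:E * (g \_ I) p.2)%E.
have gI0 s : (0 <= (g \_ I) s)%E.
  by rewrite patchE; case: ifPn => //; rewrite inE => /g0.
have mgI : measurable_fun [set: measurableTypeR R] (g \_ I).
  exact: ((measurable_restrictT g mI).1 (measurable_funTS mg)).
have F0 p : (0 <= F p)%E by rewrite mule_ge0// lee_fin.
have mF : measurable_fun setT F.
  apply: emeasurable_funM; first exact/measurable_EFinP/measurable_indic.
  exact: measurableT_comp mgI measurable_snd.
apply: (@le_trans _ _ (\int[mu]_(z in B) ((2 ^+ N.+1)%:E * \int[leb]_s F (z, s)))%E).
  apply: ge0_le_integral => //.
  - by move=> z _; rewrite mule_ge0// lee_fin invr_ge0 exprn_ge0// enorm_ge0.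
  - apply: measurable_funTS; apply: emeasurable_funM; last first.
      apply/measurable_EFinP; apply: measurable_funV; apply: measurable_funX.
      exact: (mrho _ _ id).
    exact: (measurableT_comp mw (mrho _ _ id _)).
  - apply: measurable_funTS; apply: measurable_funeM.
    exact: measurable_fun_fubini_tonelli_F.
  move=> z Bz.
  have [->|zx] := eqVneq z x.
    rewrite subrr enorm0 expr0n gtn_eqF// invr0 mule0 mule_ge0//.
    exact: integral_ge0.
  have rz : 0 < rho z by rewrite /rho enormB_gt0.
  have rz1 : rho z < 2^-1 by exact: Bz.
  set a := rho z in rz rz1 *.
  have -> : (\int[leb]_s F (z, s) = \int[leb]_(s in `[a, (2 * a)%R]) g s)%E.
    rewrite [RHS]integral_mkcond; apply: eq_integral => s _; rewrite /F/= !patchE indicE.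
    rewrite (_ : ((z, s) \in E) = (s \in `[a, 2 * a]%classic)); last first.
      by apply/idP/idP; rewrite !inE /E/= in_itv/= => /andP.
    case: (boolP (s \in `[a, 2 * a]%classic)); last by rewrite mul0e.
    rewrite inE /= in_itv/= => /andP[as_ s2]; rewrite mul1e mem_set// /I/= in_itv/=.
    by apply/andP; split; lra.
  have -> : (w a * (a ^- N)%:E =
      (2 ^+ N.+1)%:E * \int[leb]_(s in `[a, (2 * a)%R]) (w a * ((2 * a) ^- N.+1)%:E))%E.
    rewrite integral_cst//= lebesgue_measure_itv/= lte_fin ltr_pMl// ltr1n -EFinB.
    rewrite ltnSn -muleA [RHS]muleCA -!EFinM; congr (_ * _%:E)%E.
    rewrite exprMn (exprS a); have aN : a ^+ N != 0 by rewrite expf_neq0// gt_eqF.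
    have tN : 2 ^+ N.+1 != 0 :> R by rewrite expf_neq0.
    by move: (2 ^+ N.+1) (a ^+ N) tN aN => c b c0 b0; field; rewrite c0 b0 gt_eqF.
  rewrite lee_pmul2l//.
  apply: ge0_le_integral => //.
  - by move=> s _; rewrite mule_ge0// lee_fin invr_ge0 exprn_ge0// mulr_ge0// ltW.
  - exact: measurable_funTS.
  move=> s; rewrite /= in_itv/= => /andP[as_ s2].
  have s0 : 0 < s by exact: lt_le_trans as_.
  apply: lee_pmul => //; first by rewrite lee_fin invr_ge0 exprn_ge0// mulr_ge0// ltW.
    exact: w_nd.
  by rewrite lee_fin lef_pV2 ?posrE ?exprn_gt0 ?mulr_gt0// lerXn2r ?nnegrE ?mulr_ge0// ltW.
rewrite ge0_integralZl//; last 2 first.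
- by apply: measurable_funTS; exact: measurable_fun_fubini_tonelli_F.
- by move=> z _; exact: integral_ge0.
rewrite EFinM -muleA lee_pmul2l//.
apply: (@le_trans _ _ (\int[mu]_z \int[leb]_s F (z, s))%E).
  apply: ge0_subset_integral => //; first exact: measurable_fun_fubini_tonelli_F.
  by move=> z _; exact: integral_ge0.
rewrite fubini_tonelli// -ge0_integralZl//; last 3 first.
- apply: emeasurable_funM; first exact: measurable_funTS.
  by apply/measurable_EFinP; apply: measurable_funTS; exact: measurable_funV.
- move=> s; rewrite /= in_itv/= => /andP[s0 _].
  by rewrite mule_ge0// lee_fin invr_ge0 ltW.
- by rewrite lee_fin mulr_ge0// ?exprn_ge0// unit_ball_volume_ge0.
rewrite [leRHS]integral_mkcond; apply: ge0_le_integral => //.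
- by move=> s _; exact: integral_ge0.
- exact: measurable_fun_fubini_tonelli_G.
- apply/(measurable_restrictT _ mI); apply: measurable_funeM; apply: measurable_funTS.
  by apply: emeasurable_funM => //; apply/measurable_EFinP; exact: measurable_funV.
have mE2 s : measurable_fun setT (fun z => (\1_E (z, s) : R)%:E).
  apply/measurable_EFinP; apply: (measurableT_comp (measurable_indic mE)).
  exact: pair2_measurable.
move=> s _; rewrite /F/= ge0_integralZr//=.
rewrite !patchE; case: ifPn => sI; last by rewrite mule0.
move: sI; rewrite inE /I/= in_itv/= => /andP[s0 s1].
have -> : ((2 ^+ N * V)%:E * (w s * (s^-1)%:E) = ((2 * s) ^+ N * V)%:E * g s)%E.
  rewrite /g muleCA [RHS]muleCA -!EFinM; congr (_ * _%:E)%E.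
  rewrite exprMn (exprS s); have sN : s ^+ N != 0 by rewrite expf_neq0// gt_eqF.
  by move: (2 ^+ N) (s ^+ N) sN => c b b0; field; rewrite b0 gt_eqF.
rewrite -(@lebesgue_eball _ _ x)// ?mulr_gt0// lee_wpmul2r//.
  by rewrite mule_ge0// lee_fin invr_ge0 exprn_ge0// ltW.
rewrite -(setIT (eball x (2 * s))) -integral_indic//; last exact: measurable_eball.
apply: ge0_le_integral => //.
- by apply/measurable_EFinP; apply: measurable_indic; exact: measurable_eball.
move=> z _; rewrite lee_fin !indicE ler_nat.
case: (boolP ((z, s) \in E)) => //; rewrite inE => -[/= zs _].
by rewrite mem_set// /eball/=; rewrite /rho in zs; lra.
Qed.

End radial_kernel.

(** * Power estimates, potentials and Dini continuity *)

Section power_estimates.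
Context {R : realType}.
Implicit Types (a b d M : R).

Lemma normr_subXn_le n a b M : 0 <= a <= M -> 0 <= b <= M ->
  `|a ^+ n - b ^+ n| <= n%:R * M ^+ n.-1 * `|a - b|.
Proof.
move=> /andP[a0 aM] /andP[b0 bM]; have M0 : 0 <= M by exact: le_trans aM.
elim: n => [|n IHn]; first by rewrite !expr0 subrr normr0 !mul0r.
rewrite /= !exprS (_ : _ - _ = a * (a ^+ n - b ^+ n) + (a - b) * b ^+ n); last by ring.
rewrite (le_trans (ler_normD _ _))// !normrM (ger0_norm a0) (ger0_norm (exprn_ge0 n b0)).
rewrite -natr1 !mulrDl mul1r lerD//; last first.
  by rewrite mulrC ler_wpM2r// lerXn2r// nnegrE.
apply: (@le_trans _ _ (M * (n%:R * M ^+ n.-1 * `|a - b|))).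
  by rewrite ler_pM.
case: n {IHn} => [|n]; first by rewrite !mul0r mulr0.
by rewrite !mulrA (mulrC M) -!mulrA ler_wpM2l// /= exprS !mulrA.
Qed.

Lemma normr_subVXn_le n a b d M : 0 < d -> d <= a <= M -> d <= b <= M ->
  `|a ^- n - b ^- n| <= n%:R * M ^+ n.-1 / d ^+ (n + n) * `|a - b|.
Proof.
move=> d0 /andP[da aM] /andP[db bM].
have a0 : 0 < a by exact: lt_le_trans da.
have b0 : 0 < b by exact: lt_le_trans db.
have an0 := exprn_gt0 n a0; have bn0 := exprn_gt0 n b0.
have -> : a ^- n - b ^- n = (b ^+ n - a ^+ n) / (a ^+ n * b ^+ n).
  by field; rewrite !gt_eqF.
rewrite normrM mulrAC ler_pM//.
  by rewrite distrC normr_subXn_le// ?(ltW a0) ?(ltW b0).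
rewrite gtr0_norm ?invr_gt0 ?mulr_gt0// lef_pV2 ?posrE ?mulr_gt0 ?exprn_gt0//.
by rewrite exprD; apply: ler_pM; rewrite ?exprn_ge0 ?(ltW d0)// lerXn2r ?nnegrE ?(ltW d0) ?(ltW a0) ?(ltW b0).
Qed.

End power_estimates.

Section potential.
Context {R : realType} {N : nat}.
Hypothesis N_gt0 : (0 < N)%N.
Local Notation mu := (lebesgue_rV N).
Local Notation leb := (@lebesgue_measure R).
Implicit Types (x y z : 'rV[R]_N).

Definition potential x z : R := enorm (x - z) / enorm (x - z) ^+ N.

Lemma potential_ge0 x z : 0 <= potential x z.
Proof. by rewrite divr_ge0 ?exprn_ge0 ?enorm_ge0. Qed.

Lemma measurable_potential x : measurable_fun setT (potential x).
Proof.
apply: (@measurable_div_enorm _ _ (fun z => enorm (x - z))).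
by apply: measurable_enorm; exact: measurable_rVB.
Qed.

Lemma potential_le x z e D : 0 < e -> e <= enorm (x - z) <= D ->
  potential x z <= D / e ^+ N.
Proof.
move=> e0 /andP[ez zD]; have z0 := lt_le_trans e0 ez.
apply: ler_pM; rewrite ?invr_ge0 ?exprn_ge0 ?enorm_ge0//.
by rewrite lef_pV2 ?posrE ?exprn_gt0// lerXn2r ?nnegrE ?enorm_ge0 ?(ltW e0).
Qed.

(** The uniformity in the centre [x] is what makes the later estimates uniform up
    to the boundary. *)
Lemma integral_potential_le D : 0 < D -> exists2 C, 0 <= C & forall x,
  (\int[mu]_(z in eball x D) (potential x z)%:E <= C%:E)%E.
Proof.
move=> D0; pose V := unit_ball_volume (R := R) (N := N).
have V0 : 0 <= V by exact: unit_ball_volume_ge0.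
(* Bound of the potential at distances between [1 / 2] and [D]. *)
pose M := D / 2^-1 ^+ N; have M0 : 0 <= M by rewrite divr_ge0 ?exprn_ge0// ltW.
exists (2 ^+ N.+1 * (2 ^+ N * V) + M * (D ^+ N * V)).
  by rewrite addr_ge0// !mulr_ge0// ?exprn_ge0// ltW.
move=> x; pose H := eball x 2^-1; pose B := eball x D.
have mH : measurable H by exact: measurable_eball.
have mB : measurable B by exact: measurable_eball.
have mp : measurable_fun setT (fun z => (potential x z)%:E).
  by apply/measurable_EFinP; exact: measurable_potential.
have p0 z : (0 <= (potential x z)%:E)%E by rewrite lee_fin potential_ge0.
apply: (@le_trans _ _ (\int[mu]_(z in H `|` (B `\` H)) (potential x z)%:E)%E).
  apply: ge0_subset_integral => //; first by apply: measurableU => //; exact: measurableD.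
    exact: measurable_funTS.
  by move=> z Bz; have [Hz|nHz] := pselect (H z); [left|right].
rewrite ge0_integral_setU//; last 3 first.
- exact: measurableD.
- exact: measurable_funTS.
- by apply/disj_setPS => z [? [_ ?]].
rewrite EFinD leeD//.
  pose w (s : R) : \bar R := (Num.max s 0)%:E.
  have -> : (\int[mu]_(z in H) (potential x z)%:E =
      \int[mu]_(z in H) (w (enorm (z - x)) * (enorm (z - x) ^- N)%:E))%E.
    apply: eq_integral => z _; rewrite /w max_l ?enorm_ge0// -EFinM.
    by rewrite /potential enormC.
  apply: (le_trans (integral_radial_le N_gt0 x _ _)).
  - by move=> s t st; rewrite lee_fin ge_max !le_max st lexx orbT.
  - by move=> s; rewrite lee_fin le_max lexx orbT.
  rewrite (eq_integral (cst 1%E)).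
    by rewrite integral_cst//= lebesgue_measure_itv/= lte01 sube0 !mule1.
  move=> s; rewrite inE/= in_itv/= => /andP[s0 _].
  by rewrite /w max_l ?ltW// -EFinM divff// gt_eqF.
apply: (@le_trans _ _ (\int[mu]_(z in B `\` H) (M%:E))%E).
  apply: ge0_le_integral => //; first exact: measurableD.
    exact: measurable_funTS.
  move=> z [/= Bz /negP]; rewrite -leNgt => Hz; rewrite lee_fin potential_le//.
  by rewrite enormC Hz /= ltW.
rewrite integral_cst; last exact: measurableD.
rewrite [leRHS]EFinM lee_wpmul2l//.
rewrite -(lebesgue_eball x D0) le_measure ?inE//; first exact: measurableD.
Qed.

Lemma integrable_potential x D : 0 < D ->
  mu.-integrable (eball x D) (EFin \o potential x).
Proof.
move=> D0; apply/integrableP; split.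
  by apply: measurable_funTS; apply/measurable_EFinP; exact: measurable_potential.
have [C _ pC] := integral_potential_le D0.
rewrite (le_lt_trans _ (ltry C))// (le_trans _ (pC x))//.
by under eq_integral do rewrite /= ger0_norm ?potential_ge0//.
Qed.

End potential.

Section dini.
Context {R : realType} {N : nat}.
Hypothesis N_gt0 : (0 < N)%N.
Local Notation mu := (lebesgue_rV N).
Local Notation leb := (@lebesgue_measure R).
Implicit Types (x y z : 'rV[R]_N) (U : set 'rV[R]_N) (v : 'rV[R]_N -> R).

Lemma modulus_nd U v x : {homo modulus U v x : s t / s <= t >-> (s <= t)%E}.
Proof.
move=> s t st; apply: le_ereal_sup => _ [y [Uy ys] <-].
by exists y => //; split => //; exact: le_trans st.
Qed.

Lemma modulus_ub U v x y s : U y -> enorm (y - x) <= s ->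
  (`|v y - v x|%:E <= modulus U v x s)%E.
Proof. by move=> Uy ys; apply: ereal_sup_ubound; exists y. Qed.

Lemma modulus_ge0 U v x s : U x -> 0 <= s -> (0 <= modulus U v x s)%E.
Proof.
move=> Ux s0; apply: le_trans (@modulus_ub U v x x s Ux _); first by rewrite lee_fin.
by rewrite subrr enorm0.
Qed.

Lemma measurable_div_itv (w : R -> \bar R) (D : set (measurableTypeR R)) :
  {homo w : s t / s <= t >-> (s <= t)%E} ->
  measurable_fun D (fun s => w s * (s^-1)%:E)%E.
Proof.
move=> w_nd; apply: measurable_funTS; apply: emeasurable_funM.
  exact: (@nondecreasing_emeasurable R setT).
by apply/measurable_EFinP; exact: measurable_funV.
Qed.

Lemma dini_integrable v x : measurable_fun setT v -> dini_continuous v x ->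
  exists2 e, 0 < e & mu.-integrable (eball x e) (EFin \o diff_quotient v x).
Proof.
move=> mv [U [oU Ux dU]]; have [e0 e00 eU] := (openE_eball U).1 oU x Ux.
pose e := Num.min e0 2^-1; exists e; first by rewrite lt_min e00/=.
(* The modulus is [-oo] at negative radii, where the supremum is empty. *)
pose w s := maxe (modulus U v x s) 0%E.
have w_nd : {homo w : s t / s <= t >-> (s <= t)%E}.
  by move=> s t st; rewrite ge_max !le_max (modulus_nd U v x st) lexx orbT.
have w0 s : (0 <= w s)%E by rewrite le_max lexx orbT.
have mdq := measurable_diff_quotient x mv.
have mw : measurable_fun setT
    (fun z => w (enorm (z - x)) * (enorm (z - x) ^- N)%:E)%E.
  apply: emeasurable_funM.
    apply: (measurableT_comp (nondecreasing_emeasurable measurableT w_nd)).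
    by apply: measurable_enorm; exact: measurable_rVB.
  apply/measurable_EFinP; apply: measurable_funV; apply: measurable_funX.
  by apply: measurable_enorm; exact: measurable_rVB.
have wN0 z : (0 <= w (enorm (z - x)) * (enorm (z - x) ^- N)%:E)%E.
  by rewrite mule_ge0// lee_fin invr_ge0 exprn_ge0// enorm_ge0.
apply/integrableP; split.
  by apply: measurable_funTS; exact/measurable_EFinP.
apply: (@le_lt_trans _ _ (\int[mu]_(z in eball x 2^-1)
    (w (enorm (z - x)) * (enorm (z - x) ^- N)%:E))%E).
  apply: (@le_trans _ _ (\int[mu]_(z in eball x e)
      (w (enorm (z - x)) * (enorm (z - x) ^- N)%:E))%E).
    apply: ge0_le_integral => //.
    - exact: measurable_eball.
    - by apply: measurable_funTS; apply/measurable_EFinP; exact: measurableT_comp.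
    - exact: measurable_funTS.
    move=> z; rewrite /eball/= lt_min => /andP[ze _].
    rewrite /diff_quotient normrM normfV (enormC x) (ger0_norm (exprn_ge0 _ (enorm_ge0 _))).
    rewrite EFinM lee_wpmul2r ?lee_fin ?invr_ge0 ?exprn_ge0 ?enorm_ge0//.
    by rewrite le_max distrC modulus_ub//; exact: eU.
  apply: ge0_subset_integral => //; first exact: measurable_eball.
  - exact: measurable_eball.
  - exact: measurable_funTS.
  - by move=> z; rewrite /eball/= lt_min => /andP[].
apply: (le_lt_trans (integral_radial_le N_gt0 x w_nd w0)).
apply: lte_mul_pinfty => //.
  by rewrite lee_fin !mulr_ge0 ?exprn_ge0 ?unit_ball_volume_ge0.
rewrite [X in (X < _)%E](_ : _ = \int[leb]_(s in `]0%R, 1%R[)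
  (modulus U v x s * (s^-1)%:E))%E//.
apply: eq_integral => s; rewrite inE/= in_itv/= => /andP[s0 _].
by rewrite /w; congr (_ * _)%E; apply/max_idPl; rewrite modulus_ge0// ltW.
Qed.

(** The rescaled modulus that a Lipschitz change of variables produces; the
    truncation at [d] is there because the modulus need only be finite near
    [0]. *)
Lemma dini_rescale (w : R -> \bar R) (L d : R) :
  {homo w : s t / s <= t >-> (s <= t)%E} -> (forall s, 0 <= w s)%E ->
  0 < L -> 0 < d -> L * d <= 2^-1 -> d < 1 ->
  (\int[leb]_(s in `]0%R, 1%R[) (w s * (s^-1)%:E) < +oo)%E ->
  (\int[leb]_(s in `]0%R, 1%R[) (w (L * Num.min s d)%R * (s^-1)%:E) < +oo)%E.
Proof.
move=> w_nd w0 L0 d0 Ld d1 wfin.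
have mw := @measurable_div_itv w _ w_nd.
(* This value is a lower bound of [w] between [1 / 2] and [1], where [w] has a
   finite integral. *)
have wld : (w (L * d)%R < +oo)%E.
  have : (w (L * d)%R * (2^-1)%:E < +oo)%E.
    apply: le_lt_trans wfin.
    apply: (@le_trans _ _ (\int[leb]_(s in `]2^-1%R, 1%R[) (w s * (s^-1)%:E))%E); last first.
      apply: ge0_subset_integral => //.
      - move=> s; rewrite /= in_itv/= => /andP[s0 _].
        by rewrite mule_ge0// lee_fin invr_ge0 ltW.
      - by apply: subset_itv => //; rewrite bnd_simp.
    have -> : (w (L * d)%R * (2^-1)%:E = \int[leb]_(s in `]2^-1%R, 1%R[) (w (L * d)%R))%E.
      rewrite integral_cst//= lebesgue_measure_itv/= lte_fin ifT; last by lra.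
      by rewrite -EFinB; congr (_ * _%:E)%E; field.
    apply: ge0_le_integral => //.
    move=> s; rewrite /= in_itv/= => /andP[s0 s1].
    rewrite -[leLHS]mule1 lee_pmul// ?w_nd//; first by rewrite (le_trans Ld)// ltW.
    by rewrite lee_fin invf_ge1// ?ltW//; lra.
  have := w0 (L * d); case: (w (L * d)%R) => [c _ _||] //; first exact: ltry.
  by move=> _; rewrite mulyr gtr0_sg// mul1e.
have mmin : measurable_fun setT (fun s : measurableTypeR R => w (L * Num.min s d)%R * (s^-1)%:E)%E.
  apply: emeasurable_funM; last by apply/measurable_EFinP; exact: measurable_funV.
  apply: (@nondecreasing_emeasurable R setT) => // s t st.
  by apply: w_nd; rewrite ler_pM2l// le_min !ge_min st lexx orbT.
have min0 s : 0 < s -> (0 <= w (L * Num.min s d)%R * (s^-1)%:E)%E.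
  by move=> s0; rewrite mule_ge0// lee_fin invr_ge0 ltW.
have -> : (`]0, 1[%classic : set (measurableTypeR R)) = `]0, d] `|` `]d, 1[.
  by rewrite -itv_bndbnd_setU// bnd_simp// ltW.
rewrite ge0_integral_setU//; last 3 first.
- exact: measurable_funTS.
- move=> s [|]; rewrite /= in_itv/= => /andP[s0 _]; apply: min0 => //.
  exact: lt_trans s0.
- apply/disj_setPS => s [/=]; rewrite !in_itv/= => /andP[_ sd] /andP[ds _].
  by have := lt_le_trans ds sd; rewrite ltxx.
apply: lte_add_pinfty.
  have -> : (\int[leb]_(s in `]0%R, d]) (w (L * Num.min s d)%R * (s^-1)%:E) =
      \int[leb]_(s in `]0%R, (L * d)%R]) (w s * (s^-1)%:E))%E.
    rewrite integral_mkcond [RHS]integral_mkcond.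
    pose G : measurableTypeR R -> \bar R := ((fun s => w s * (s^-1)%:E) \_ `]0%R, (L * d)%R])%E.
    rewrite -[RHS]/(\int[leb]_s G s)%E.
    have mG : measurable_fun [set: measurableTypeR R] G.
      exact: ((measurable_restrictT _ (measurable_itv _)).1 (mw _)).
    have G0 s : (0 <= G s)%E.
      rewrite /G patchE; case: ifPn => //; rewrite inE/= in_itv/= => /andP[s0 _].
      by rewrite mule_ge0// lee_fin invr_ge0 ltW.
    rewrite -[RHS](@ge0_integral_affine _ L 0)//; last by rewrite gt_eqF.
    rewrite -ge0_integralZl//; last first.
      apply: (measurableT_comp mG).
      by apply: measurable_funD => //; exact: measurable_funM.
    apply: eq_integral => s _; rewrite /G !patchE addr0 gtr0_norm//.
    have -> : (L * s \in `]0, L * d]%classic) = (s \in `]0, d]%classic).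
      apply/idP/idP; rewrite !inE/= !in_itv/= pmulr_rgt0// ler_pM2l//.
    case: ifPn; last by rewrite mule0.
    rewrite inE/= in_itv/= => /andP[s0 sd].
    rewrite min_l// muleCA -EFinM; congr (_ * _%:E)%E.
    by field; rewrite !gt_eqF.
  apply: le_lt_trans wfin; apply: ge0_subset_integral => //.
  - move=> s; rewrite /= in_itv/= => /andP[s0 _].
    by rewrite mule_ge0// lee_fin invr_ge0 ltW.
  - by apply: subset_itv => //; rewrite bnd_simp; lra.
apply: (@le_lt_trans _ _ (\int[leb]_(s in `]d, 1%R[) (w (L * d)%R * (d^-1)%:E))%E).
  apply: ge0_le_integral => //.
  - by move=> s; rewrite /= in_itv/= => /andP[s0 _]; apply: min0; exact: lt_trans s0.
  - exact: measurable_funTS.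
  move=> s; rewrite /= in_itv/= => /andP[ds _].
  rewrite min_r ?(ltW ds)// lee_wpmul2l// lee_fin lef_pV2 ?posrE ?(ltW ds)//.
  exact: lt_trans ds.
rewrite integral_cst//= lebesgue_measure_itv/= lte_fin d1 -EFinB.
have := w0 (L * d); move: wld; case: (w (L * d)%R) => [c _ _||] //.
by rewrite -!EFinM ltry.
Qed.

End dini.

(** * Dini continuity of the Kelvin transform *)

Section kelvin_dini.
Context {R : realType} {N : nat}.
Variables (x0 : 'rV[R]_N) (r : R).
Hypotheses (N_gt0 : (0 < N)%N) (r_gt0 : 0 < r).
Local Notation mu := (lebesgue_rV N).
Local Notation leb := (@lebesgue_measure R).
Local Notation inv := (inversion x0 r).
Implicit Types (x y z : 'rV[R]_N) (u : 'rV[R]_N -> R) (U : set 'rV[R]_N).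

Lemma enorm_dist x y z : `|enorm (x - z) - enorm (y - z)| <= enorm (x - y).
Proof.
have := enorm_triangle y x z; have := enorm_triangle x y z; rewrite (enormC y x) => h1 h2.
by rewrite ler_norml; apply/andP; split; lra.
Qed.

(** In the half-size neighbourhood of [inv x] the inversion is Lipschitz and the
    weight [enorm (y - x0) ^- N] is bounded and Lipschitz. *)
Lemma kelvin_modulus_le u x y : x != x0 ->
  enorm (y - inv x) <= enorm (inv x - x0) / 2 ->
  let A := enorm (inv x - x0) in
  enorm (inv y - x) <= 2 * r ^+ 2 / A ^+ 2 * enorm (y - inv x) /\
  `|kelvin x0 r u y - kelvin x0 r u (inv x)| <=
    (A / 2) ^- N * `|u (inv y) - u x| +
    N%:R * (2 * A) ^+ N.-1 / (A / 2) ^+ (N + N) * `|u x| * enorm (y - inv x).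
Proof.
move=> xx0 yA A; have ix0 : inv x != x0 by rewrite inversion_eq_center.
have A0 : 0 < A by rewrite /A enormB_gt0.
have := enorm_dist y (inv x) x0; rewrite -/A ler_norml => /andP[d1 d2].
set e := enorm (y - inv x) in yA d1 d2 *; have e0 : 0 <= e by exact: enorm_ge0.
have BA : A / 2 <= enorm (y - x0) <= 2 * A by rewrite -/A in yA; apply/andP; split; lra.
have B0 : 0 < enorm (y - x0) by case/andP: BA => + _; apply: lt_le_trans; rewrite divr_gt0.
have yx0 : y != x0 by rewrite -enormB_gt0.
split.
  rewrite -{1}[x](@inversionK _ _ x0 r)// enorm_inversion_sub// -/e -/A.
  have -> : 2 * r ^+ 2 / A ^+ 2 * e = r ^+ 2 * e / (A / 2 * A).
    by field; rewrite gt_eqF.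
  rewrite ler_wpM2l ?mulr_ge0 ?exprn_ge0 ?(ltW r_gt0)//.
  rewrite lef_pV2 ?posrE ?mulr_gt0 ?divr_gt0//.
  by rewrite ler_pM2r//; case/andP: BA.
rewrite kelvin_inversion// {1}/kelvin -/A.
have -> : enorm (y - x0) ^- N * u (inv y) - A ^- N * u x =
    enorm (y - x0) ^- N * (u (inv y) - u x) + (enorm (y - x0) ^- N - A ^- N) * u x by ring.
rewrite (le_trans (ler_normD _ _))// !normrM lerD//.
  rewrite ler_wpM2r// ger0_norm ?invr_ge0 ?exprn_ge0 ?enorm_ge0//.
  rewrite lef_pV2 ?posrE ?exprn_gt0 ?divr_gt0// lerXn2r ?nnegrE ?divr_ge0 ?(ltW A0) ?(ltW B0)//.
  by case/andP: BA.
rewrite mulrAC ler_wpM2r//.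
rewrite (le_trans (@normr_subVXn_le _ N _ _ (A / 2) (2 * A) _ BA _)) ?divr_gt0//.
  by apply/andP; split; lra.
rewrite ler_wpM2l// ?ler_norml ?d1 ?d2//.
by rewrite !mulr_ge0// ?invr_ge0 ?exprn_ge0 ?mulr_ge0 ?divr_ge0 ?(ltW A0).
Qed.

(** On the ball of radius [d] the modulus of the Kelvin transform is at most a
    multiple of the rescaled modulus of [u] plus a linear term. *)
Lemma dini_kelvin u x : x != x0 -> dini_continuous u x ->
  dini_continuous (kelvin x0 r u) (inv x).
Proof.
move=> xx0 [U [oU Ux dU]]; have [eps eps0 epsU] := (openE_eball U).1 oU x Ux.
have ix0 : inv x != x0 by rewrite inversion_eq_center.
set us := kelvin x0 r u; set xs := inv x.
have A0 : 0 < enorm (xs - x0) by rewrite enormB_gt0.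
have := fun y => @kelvin_modulus_le u x y xx0; rewrite /= -/xs -/us.
set A := enorm (xs - x0) in A0 *; set L := 2 * r ^+ 2 / A ^+ 2.
set C1 := (A / 2) ^- N; set C2 := _ * `|u x| => est.
have L0 : 0 < L by rewrite divr_gt0 ?mulr_gt0 ?exprn_gt0.
have C10 : 0 <= C1 by rewrite invr_ge0 exprn_ge0// divr_ge0// ltW.
have C20 : 0 <= C2.
  by rewrite !mulr_ge0// ?invr_ge0 ?exprn_ge0 ?mulr_ge0 ?divr_ge0 ?(ltW A0).
pose d := Num.min (A / 2) (Num.min (eps / L) (Num.min (2^-1 / L) 2^-1)).
have d0 : 0 < d by rewrite !lt_min; repeat (apply/andP; split) => //; exact: divr_gt0.
have [dA dL dL2 d1] : [/\ d <= A / 2, L * d <= eps, L * d <= 2^-1 & d < 1].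
  split.
  - by rewrite ge_min lexx.
  - by rewrite mulrC -ler_pdivlMr// !ge_min lexx !orbT.
  - by rewrite mulrC -ler_pdivlMr// !ge_min lexx !orbT.
  - by apply: (@le_lt_trans _ _ 2^-1); [rewrite !ge_min lexx !orbT|lra].
clearbody d.
exists (eball xs d); split; [exact: eball_open|exact: eballxx|].
pose w s := maxe (modulus U u x s) 0%E.
have w_nd : {homo w : s t / s <= t >-> (s <= t)%E}.
  by move=> s t st; rewrite ge_max !le_max (modulus_nd U u x st) lexx orbT.
have w0 s : (0 <= w s)%E by rewrite le_max lexx orbT.
have wfin : (\int[leb]_(s in `]0%R, 1%R[) (w s * (s^-1)%:E) < +oo)%E.
  rewrite [X in (X < _)%E](_ : _ = \int[leb]_(s in `]0%R, 1%R[)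
    (modulus U u x s * (s^-1)%:E))%E//.
  apply: eq_integral => s; rewrite inE/= in_itv/= => /andP[s0 _].
  by rewrite /w; congr (_ * _)%E; apply/max_idPl; rewrite modulus_ge0// ltW.
have := dini_rescale w_nd w0 L0 d0 dL2 d1 wfin.
set W := (X in (X < _)%E) => Wfin.
have mW : measurable_fun setT
    (fun s : measurableTypeR R => w (L * Num.min s d)%R * (s^-1)%:E)%E.
  apply: emeasurable_funM; last by apply/measurable_EFinP; exact: measurable_funV.
  apply: (@nondecreasing_emeasurable R setT) => // s t st.
  by apply: w_nd; rewrite ler_pM2l// le_min !ge_min st lexx orbT.
have W0 s : 0 < s -> (0 <= w (L * Num.min s d)%R * (s^-1)%:E)%E.
  by move=> s0; rewrite mule_ge0// lee_fin invr_ge0 ltW.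
have le_modulus s : 0 < s ->
    (modulus (eball xs d) us xs s <= C1%:E * w (L * Num.min s d)%R + (C2 * s)%:E)%E.
  move=> s0; apply: ge_ereal_sup => _ [y [yd ys] <-].
  have /= ydA : enorm (y - xs) <= A / 2 by rewrite (le_trans (ltW yd)).
  have [h1 h2] := est _ ydA.
  have h3 : enorm (inv y - x) <= L * Num.min s d.
    by rewrite (le_trans h1)// ler_pM2l// le_min ys ltW.
  apply: (@le_trans _ _ (C1 * `|u (inv y) - u x| + C2 * enorm (y - xs))%:E).
    by rewrite lee_fin.
  rewrite EFinD leeD//; last by rewrite lee_fin ler_wpM2l.
  rewrite EFinM lee_wpmul2l// le_max modulus_ub//; apply: epsU.
  rewrite /eball/= (le_lt_trans h1)// (lt_le_trans _ dL)// ltr_pM2l//.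
apply: (@le_lt_trans _ _ (\int[leb]_(s in `]0%R, 1%R[)
    (C1%:E * (w (L * Num.min s d)%R * (s^-1)%:E) + C2%:E))%E).
  apply: ge0_le_integral => //.
  - move=> s; rewrite /= in_itv/= => /andP[s0 _].
    by rewrite mule_ge0// ?lee_fin ?invr_ge0 ?(ltW s0)// modulus_ge0 ?ltW//; exact: eballxx.
  - by apply: measurable_div_itv; exact: modulus_nd.
  - apply: emeasurable_funD => //; apply: measurable_funeM; exact: measurable_funTS.
  move=> s; rewrite /= in_itv/= => /andP[s0 _].
  apply: (@le_trans _ _ ((C1%:E * w (L * Num.min s d)%R + (C2 * s)%:E) * (s^-1)%:E)%E).
    by rewrite lee_wpmul2r ?lee_fin ?invr_ge0 ?(ltW s0)// le_modulus.
  rewrite ge0_muleDl; last 2 first.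
  - by rewrite mule_ge0.
  - by rewrite lee_fin mulr_ge0// ltW.
  by rewrite -muleA -EFinM mulfK// gt_eqF.
rewrite ge0_integralD//; last 2 first.
- by move=> s; rewrite /= in_itv/= => /andP[s0 _]; rewrite mule_ge0// W0.
- by apply: measurable_funeM; exact: measurable_funTS.
rewrite integral_cst//= lebesgue_measure_itv/= lte01 sube0 mule1.
apply: lte_add_pinfty; last exact: ltry.
rewrite ge0_integralZl//; last 2 first.
- exact: measurable_funTS.
- by move=> s; rewrite /= in_itv/= => /andP[s0 _]; rewrite W0.
by apply: lte_mul_pinfty.
Qed.

End kelvin_dini.

(** * Convergence of the integrals, and sets away from the centre *)

Section log_laplacian_defined.
Context {R : realType} {N : nat}.
Hypothesis N_gt0 : (0 < N)%N.
Local Notation mu := (lebesgue_rV N).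
Implicit Types (x y z : 'rV[R]_N) (u : 'rV[R]_N -> R) (U : set 'rV[R]_N).

Lemma enormVn_le x y e : 0 < e -> e <= enorm (x - y) -> enorm (x - y) ^- N <= e ^- N.
Proof.
move=> e0 ey; have y0 := lt_le_trans e0 ey.
by rewrite lef_pV2 ?posrE ?exprn_gt0// lerXn2r ?nnegrE ?enorm_ge0 ?(ltW e0).
Qed.

Lemma enormVn_ge0 x y : 0 <= enorm (x - y) ^- N.
Proof. by rewrite invr_ge0 exprn_ge0// enorm_ge0. Qed.

Lemma integrable_enormVn x (D : set 'rV[R]_N) e : measurable D -> (mu D < +oo)%E ->
  0 < e -> (forall y, D y -> e <= enorm (x - y)) ->
  mu.-integrable D (EFin \o (fun y => enorm (x - y) ^- N)).
Proof.
move=> mD Doo e0 De; apply: (@integrable_bounded _ _ _ _ _ _ (e ^- N)) => //.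
  exact: measurable_enormVn.
by move=> y /De ey; rewrite ger0_norm ?enormVn_ge0// enormVn_le.
Qed.

Lemma h_defined_interior U x e : measurable U -> (mu U < +oo)%E -> 0 < e ->
  eball x e `<=` U -> h_defined U x.
Proof.
move=> mU Uoo e0 eU; have mB : measurable (eball x 1) by exact: measurable_eball.
have fin A B : measurable A -> measurable B -> (mu A < +oo)%E -> (mu (A `\` B) < +oo)%E.
  move=> mA mB'; apply: le_lt_trans; apply: le_measure; rewrite ?inE//.
  exact: measurableD.
split.
  apply: (@integrable_enormVn _ _ e) => //; first exact: measurableD.
    by apply: fin => //; exact: lebesgue_eball_lty.
  by move=> y [_ nUy]; rewrite leNgt; apply/negP => ye; apply: nUy; apply: eU; rewrite /eball/= enormC.
apply: (@integrable_enormVn _ _ 1) => //; first exact: measurableD.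
  exact: fin.
by move=> y [_ /negP]; rewrite -leNgt enormC.
Qed.

(** Dini continuity serves near [x]; elsewhere the kernel is bounded and [u] is
    integrable. *)
Lemma dini_loglap_defined u x : measurable_fun setT u -> dini_continuous u x ->
  mu.-integrable setT (EFin \o u) -> loglap_defined u x.
Proof.
move=> mfu du iu; have [e0 e00 ie0] := dini_integrable N_gt0 mfu du.
pose e := Num.min e0 1.
have [e_gt0 ee0 e1] : [/\ 0 < e, e <= e0 & e <= 1].
  by rewrite /e lt_min e00 ltr01 !ge_min !lexx orbT.
have mB s : measurable (eball x s) by exact: measurable_eball.
have iabs D : measurable D -> mu.-integrable D (EFin \o (fun y => `|u y|)).
  move=> mD; apply: (@integrableS _ _ _ mu setT) => //; exact: integrable_norm.
split.
  have -> : eball x 1 = eball x e `|` (eball x 1 `\` eball x e).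
    by rewrite setUDr setDv setD0 setUidr// => y /lt_le_trans; apply.
  apply: integrable_setU_disj => //; first exact: measurableD.
  - by apply/disj_setPS => z [? [_ ?]].
  - apply: (@integrableS _ _ _ mu (eball x e0)) => //.
    by move=> y /lt_le_trans; apply.
  have mD : measurable (eball x 1 `\` eball x e) by exact: measurableD.
  have icst : mu.-integrable (eball x 1 `\` eball x e) (EFin \o cst `|u x|).
    apply: (@integrable_bounded _ _ _ _ _ _ `|u x|) => //.
      apply: le_lt_trans (lebesgue_eball_lty x 1); apply: le_measure; rewrite ?inE//.
    by move=> y _; rewrite /= normr_id.
  apply: (@integrable_le _ _ _ _ _ _ (fun y => e ^- N * (`|u x| + `|u y|))) => //.
  - exact: measurable_diff_quotient.
  - move=> y [_ /negP]; rewrite -leNgt enormC => ey.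
    rewrite normrM (ger0_norm (enormVn_ge0 _ _)) mulrC.
    by apply: ler_pM; rewrite ?enormVn_ge0 ?enormVn_le ?ler_normB.
  apply: (@integrableZl _ _ _ mu _ mD (e ^- N) (EFin \o (fun y => `|u x| + `|u y|))).
  exact: (integrableD mD icst (iabs _ mD)).
have mC : measurable (~` eball x 1) by exact: measurableC.
apply: (@integrable_le _ _ _ _ _ _ (fun y => `|u y|)) => //; last exact: iabs.
  exact: measurable_div_enorm.
move=> y /negP; rewrite -leNgt enormC => y1.
rewrite normrM (ger0_norm (enormVn_ge0 _ _)) ler_piMr//.
by rewrite (le_trans (enormVn_le ltr01 y1))// expr1n invr1.
Qed.

End log_laplacian_defined.

Section shell.
Context {R : realType} {N : nat}.
Variables (x0 : 'rV[R]_N) (r : R).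
Hypotheses (N_gt0 : (0 < N)%N) (r_gt0 : 0 < r).
Local Notation mu := (lebesgue_rV N).
Local Notation inv := (inversion x0 r).
Implicit Types (x y z : 'rV[R]_N) (u : 'rV[R]_N -> R) (U : set 'rV[R]_N).

Definition shell (d D : R) : set 'rV[R]_N := [set z | d <= enorm (z - x0) <= D].

Lemma shell_neq d D z : 0 < d -> shell d D z -> z != x0.
Proof. by move=> d0 /andP[dz _]; rewrite -enormB_gt0 (lt_le_trans d0). Qed.

Lemma shell_inversion d D z : 0 < d -> shell d D z ->
  shell (r ^+ 2 / D) (r ^+ 2 / d) (inv z).
Proof.
move=> d0 /andP[dz zD]; have z0 := lt_le_trans d0 dz; have D0 := lt_le_trans z0 zD.
apply/andP; rewrite enorm_inversionB//.
by split; rewrite ler_pM2l ?exprn_gt0// lef_pV2 ?posrE.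
Qed.

Lemma shell_inversion_set d D U : 0 < d -> U `<=` shell d D ->
  inversion_set x0 r U `<=` shell (r ^+ 2 / D) (r ^+ 2 / d).
Proof. by move=> d0 Ud _ [z [Uz _] <-]; apply: shell_inversion => //; exact: Ud. Qed.

Lemma shell_sub_eball d D U x : U `<=` shell d D -> shell d D x ->
  U `<=` eball x (D + D + 1).
Proof.
move=> US /andP[_ xD] z /US /andP[_ zD]; rewrite /eball/=.
by have := enorm_triangle x0 z x; rewrite (enormC x0 x); lra.
Qed.

Lemma shell_lty d D U : measurable U -> U `<=` shell d D -> (mu U < +oo)%E.
Proof.
move=> mU US; apply: (@le_lt_trans _ _ (mu (eball x0 (D + 1)))); last exact: lebesgue_eball_lty.
apply: le_measure; rewrite ?inE//; first exact: measurable_eball.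
by move=> z /US /andP[_ zD]; rewrite /eball/=; lra.
Qed.

Lemma open_inversion_set U : open U -> open (inversion_set x0 r U).
Proof.
move=> oU; apply/openE_eball => y; rewrite {1}inversion_setE// => -[Uiy /eqP iyx0].
have [eps eps0 epsU] := (openE_eball U).1 oU _ Uiy.
have iiy : inv (inv y) = y by rewrite inversionK.
have A0 : 0 < enorm (y - x0) by rewrite enormB_gt0 -(inversion_eq_center _ r_gt0).
pose L := 2 * r ^+ 2 / enorm (y - x0) ^+ 2.
have L0 : 0 < L by rewrite divr_gt0 ?mulr_gt0 ?exprn_gt0.
exists (Num.min (enorm (y - x0) / 2) (eps / L)); first by rewrite lt_min; apply/andP; split; exact: divr_gt0.
move=> y'; rewrite /eball/= lt_min => /andP[y1 y2].
have [] := @kelvin_modulus_le _ _ x0 r r_gt0 (cst 0) (inv y) y' iyx0.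
  by rewrite iiy ltW.
rewrite iiy => h _; rewrite inversion_setE//; split.
  by apply: epsU; rewrite /eball/= (le_lt_trans h)// mulrC -ltr_pdivlMr.
apply/eqP; rewrite inversion_eq_center// -enormB_gt0.
by have := enorm_dist y y' x0; rewrite ler_norml (enormC y) => /andP[? ?]; lra.
Qed.

Lemma kelvin_kernel_le d D x z : 0 < d -> shell d D x -> shell d D z ->
  `|kelvin_kernel x0 x z| <= N%:R * D ^+ N.-1 / d ^+ (N + N) * potential x z.
Proof.
move=> d0 xS zS; have D0 : 0 <= D.
  by case/andP: xS => + xD; move=> /(lt_le_trans d0) /ltW /le_trans; apply.
rewrite /kelvin_kernel /potential (enormC z x) normrM (ger0_norm (enormVn_ge0 _ _)) mulrA.
rewrite ler_wpM2r ?enormVn_ge0//.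
rewrite (le_trans (normr_subVXn_le N d0 zS xS))// ler_wpM2l// ?(enormC x z) ?enorm_dist//.
by rewrite !mulr_ge0// ?invr_ge0 ?exprn_ge0// ltW.
Qed.

Lemma integrable_kelvin_kernel d D U x : 0 < d -> measurable U ->
  U `<=` shell d D -> shell d D x ->
  mu.-integrable U (EFin \o kelvin_kernel x0 x).
Proof.
move=> d0 mU US xS; set K := N%:R * D ^+ N.-1 / d ^+ (N + N).
apply: (@integrable_le _ _ _ _ _ _ (fun z => K * potential x z)) => //.
- exact: measurable_kelvin_kernel.
- by move=> z /US zS; exact: kelvin_kernel_le.
apply: (@integrableZl _ _ _ mu _ mU K (EFin \o potential x)).
apply: (@integrableS _ _ _ mu (eball x (D + D + 1))) => //.
- exact: measurable_eball.
- exact: shell_sub_eball US xS.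
- apply: integrable_potential => //; case/andP: xS => dx xD; lra.
Qed.

Lemma Rintegral_kelvin_kernel_le d D U : 0 < d -> 0 < D -> measurable U ->
  U `<=` shell d D -> exists C, forall x, shell d D x ->
  `|\int[mu]_(z in U) kelvin_kernel x0 x z| <= C.
Proof.
move=> d0 D0 mU US; set K := N%:R * D ^+ N.-1 / d ^+ (N + N).
have K0 : 0 <= K by rewrite !mulr_ge0// ?invr_ge0 ?exprn_ge0// ltW.
have E0 : 0 < D + D + 1 by lra.
have [C C0 pC] := integral_potential_le N_gt0 E0.
exists (K * C) => x xS; rewrite -lee_fin.
have ik := integrable_kelvin_kernel d0 mU US xS.
rewrite (EFin_normr_Rintegral mU ik) (le_trans (le_abse_integral mu mU (measurable_int mu ik)))//.
have mp : measurable_fun setT (fun z => (potential x z)%:E).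
  by apply/measurable_EFinP; exact: measurable_potential.
have p0 z : (0 <= (potential x z)%:E)%E by rewrite lee_fin potential_ge0.
have mE : measurable (eball x (D + D + 1)) by exact: measurable_eball.
apply: (@le_trans _ _ (\int[mu]_(z in U) (K%:E * (potential x z)%:E))%E).
  apply: ge0_le_integral => //.
  - by apply: measurableT_comp => //; exact: measurable_int ik.
  - by apply: measurable_funeM; exact: measurable_funTS.
  by move=> z /US zS; rewrite /= lee_fin kelvin_kernel_le.
rewrite ge0_integralZl//; last exact: measurable_funTS.
rewrite [leRHS]EFinM lee_wpmul2l// (le_trans _ (pC x))//.
apply: ge0_subset_integral => //; first exact: measurable_funTS.
exact: shell_sub_eball US xS.
Qed.

End shell.

(** * The difference of the functions h_ *)

Section h_inversion.
Context {R : realType} {N : nat}.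
Variables (x0 : 'rV[R]_N) (r : R).
Hypotheses (N_gt0 : (0 < N)%N) (r_gt0 : 0 < r).
Local Notation mu := (lebesgue_rV N).
Local Notation inv := (inversion x0 r).
Local Notation J := (inversion_jacobian x0 r).
Local Notation shell := (shell x0).
Implicit Types (x y z : 'rV[R]_N) (u : 'rV[R]_N -> R) (U : set 'rV[R]_N).

Lemma inversion_setK U : ~ U x0 -> inversion_set x0 r (inversion_set x0 r U) = U.
Proof.
move=> nU; rewrite !inversion_setE//; apply/seteqP; split => z.
  by move=> [[]]; rewrite inversionK.
move=> Uz; have zx0 : z != x0 by apply/eqP => zx0; apply: nU; rewrite -zx0.
split; first by rewrite /= inversionK//; split => //; exact/eqP.
by apply/eqP; rewrite inversion_eq_center.
Qed.

(** The radius is uniform in [x], because the shell keeps [x] and its image away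
    from the singularities [x0] and infinity. *)
Lemma near_inversion d D : 0 < d -> d <= D -> exists2 del, 0 < del <= 1 &
  forall x y, shell d D x -> enorm (y - inv x) < del ->
  shell (d / 2) (2 * D) (inv y) /\ enorm (inv y - x) < 1.
Proof.
move=> d0 dD; have D0 : 0 < D by exact: lt_le_trans dD.
have r2 : 0 < r ^+ 2 by rewrite exprn_gt0.
(* The second bound keeps [y] at least at half the distance of [inv x] from
   [x0]; the third one brings [inv y] within [1] of [x]. *)
pose del := Num.min 1 (Num.min (r ^+ 2 / (2 * D)) (r ^+ 2 / (4 * D ^+ 2))).
have [del0 del1 del2 del3] : [/\ 0 < del, del <= 1, del <= r ^+ 2 / (2 * D) &
    del <= r ^+ 2 / (4 * D ^+ 2)].
  rewrite /del; split; last 3 first.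
  - by rewrite ge_min lexx.
  - by rewrite !ge_min lexx !orbT.
  - by rewrite !ge_min lexx !orbT.
  - rewrite !lt_min; repeat (apply/andP; split) => //; apply: divr_gt0 => //.
      by rewrite mulr_gt0.
    by rewrite mulr_gt0// exprn_gt0.
exists del; first by rewrite del0.
move=> x y xS yx; have xx0 := shell_neq d0 xS.
have a0 : 0 < enorm (x - x0) by rewrite enormB_gt0.
have iS := shell_inversion r_gt0 d0 xS; case/andP: xS => da aD; case/andP: iS => i1 i2.
have := enorm_dist y (inv x) x0; rewrite ler_norml => /andP[t1 t2].
have hD : r ^+ 2 / (2 * D) = r ^+ 2 / D / 2 by field; rewrite gt_eqF.
have hdD : r ^+ 2 / D <= r ^+ 2 / d by rewrite ler_pM2l// lef_pV2.
have e1 : r ^+ 2 / (2 * D) < enorm (y - x0) by lra.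
have e2 : enorm (y - x0) < 2 * (r ^+ 2 / d) by have : 0 < r ^+ 2 / d := divr_gt0 r2 d0; lra.
have y0 : 0 < enorm (y - x0) by apply: lt_trans e1; rewrite divr_gt0// mulr_gt0.
have yx0 : y != x0 by rewrite -enormB_gt0.
have bE : enorm (inv y - x0) = r ^+ 2 / enorm (y - x0) by exact: enorm_inversionB.
have b2 : enorm (inv y - x0) <= 2 * D.
  by rewrite bE ler_pdivrMr// mulrC -ler_pdivrMr ?mulr_gt0// ltW.
have b1 : d / 2 <= enorm (inv y - x0).
  rewrite bE ler_pdivlMr// -ler_pdivlMl ?divr_gt0//.
  by rewrite (le_trans (ltW e2))// le_eqVlt; apply/orP; left; apply/eqP; field; rewrite gt_eqF.
split; first by apply/andP.
have ix0 : inv x != x0 by rewrite inversion_eq_center.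
rewrite -{1}[x](@inversionK _ _ x0 r)// enorm_inversion_sub//.
have -> : r ^+ 2 * enorm (y - inv x) / (enorm (y - x0) * enorm (inv x - x0)) =
    enorm (y - inv x) * enorm (inv y - x0) * enorm (x - x0) / r ^+ 2.
  by rewrite bE enorm_inversionB//; field; rewrite !gt_eqF.
rewrite ltr_pdivrMr// mul1r.
have p0 := enorm_ge0 (y - inv x); have q0 := enorm_ge0 (inv y - x0).
have h4 : enorm (y - inv x) * (4 * D ^+ 2) <= r ^+ 2.
  by rewrite -ler_pdivlMr ?mulr_gt0 ?exprn_gt0// (le_trans (ltW yx)).
have h5 : enorm (inv y - x0) * enorm (x - x0) <= 2 * D ^+ 2.
  by rewrite expr2 mulrA; apply: ler_pM => //; exact: ltW.
have h6 : enorm (y - inv x) * (enorm (inv y - x0) * enorm (x - x0)) <=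
   enorm (y - inv x) * (2 * D ^+ 2) by rewrite ler_wpM2l.
rewrite -mulrA (le_lt_trans h6)//.
by move: h4; move: (enorm (y - inv x)) (D ^+ 2) p0 => e E p0; nra.
Qed.

Lemma enormVn_inversion x z : x != x0 -> z != x0 ->
  enorm (inv x - inv z) ^- N * J z =
  enorm (x - x0) ^+ N * enorm (z - x0) ^- N * enorm (x - z) ^- N.
Proof.
move=> xx0 zx0; have [->|xz] := eqVneq x z.
  by rewrite !subrr enorm0 expr0n gtn_eqF// invr0 !(mulr0, mul0r).
rewrite enorm_inversion_sub// /inversion_jacobian.
rewrite !(mulnC 2%N) !exprM !(expr_div_n, exprMn).
have : 0 < enorm (x - x0) ^+ N by rewrite exprn_gt0// enormB_gt0.
have : 0 < enorm (z - x0) ^+ N by rewrite exprn_gt0// enormB_gt0.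
have : 0 < enorm (x - z) ^+ N by rewrite exprn_gt0// enormB_gt0.
have : 0 < r ^+ N by rewrite exprn_gt0.
move: (enorm (x - x0) ^+ N) (enorm (z - x0) ^+ N) (enorm (x - z) ^+ N) (r ^+ N).
by move=> a b e s s0 e0 b0 a0; field; rewrite !gt_eqF.
Qed.

(** In the variable [z = inv y] the kernel about [inv x] is the kernel about [x]
    times a factor [1 + O(enorm (x - z))], so the two singular integrals differ
    by a potential. *)
Lemma integral_outside_inversion_le d D U : 0 < d -> d <= D -> measurable U ->
  exists2 C, 0 <= C & forall x, shell d D x ->
  (\int[mu]_(y in eball (inv x) 1 `\` inversion_set x0 r U) (enorm (inv x - y) ^- N)%:E <=
   \int[mu]_(z in eball x 1 `\` U) (enorm (x - z) ^- N)%:E + C%:E)%E.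
Proof.
move=> d0 dD mU; have D0 : 0 < D by exact: lt_le_trans dD.
have [del /andP[del0 del1] near] := near_inversion d0 dD.
have [C1 C10 pC1] := integral_potential_le N_gt0 (@ltr01 R).
pose V := unit_ball_volume (R := R) (N := N).
have V0 : 0 <= V by exact: unit_ball_volume_ge0.
pose K := D ^+ N * (N%:R * (2 * D) ^+ N.-1 / (d / 2) ^+ (N + N)).
have K0 : 0 <= K.
  by rewrite !mulr_ge0// ?invr_ge0 ?exprn_ge0 ?mulr_ge0 ?divr_ge0 ?(ltW D0) ?(ltW d0).
exists (K * C1 + del ^- N * V).
  by apply: addr_ge0; rewrite mulr_ge0// invr_ge0 exprn_ge0// ltW.
move=> x xS; set xs := inv x; set Us := inversion_set x0 r U.
have xx0 := shell_neq d0 xS.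
have mk y : measurable_fun setT (fun z => (enorm (y - z) ^- N)%:E).
  by apply/measurable_EFinP; exact: measurable_enormVn.
have k0 y z : (0 <= (enorm (y - z) ^- N)%:E)%E by rewrite lee_fin enormVn_ge0.
have mB y e : measurable (eball y e : set 'rV[R]_N) by exact: measurable_eball.
have mUs : measurable Us by exact: measurable_inversion_set.
pose S := eball xs del `\` Us.
have mS : measurable S by exact: measurableD.
pose A := eball xs 1 `\` eball xs del.
have mA : measurable A by exact: measurableD.
apply: (@le_trans _ _ (\int[mu]_(y in S `|` A) (enorm (xs - y) ^- N)%:E)%E).
  apply: ge0_subset_integral => //; [exact: measurableD|exact: measurableU|exact: measurable_funTS|].
  move=> y [y1 nUy]; have [yd|nyd] := pselect (eball xs del y); first by left.
  by right.
rewrite ge0_integral_setU//; last 2 first.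
- exact: measurable_funTS.
- by apply/disj_setPS => z [[? _] [_ ?]].
rewrite EFinD addeA leeD//; last first.
  apply: (@le_trans _ _ (\int[mu]_(y in A) (del ^- N)%:E)%E).
    apply: ge0_le_integral => //; first exact: measurable_funTS.
    move=> y [_ /negP]; rewrite -leNgt enormC => dy.
    by rewrite lee_fin enormVn_le.
  rewrite integral_cst// EFinM lee_wpmul2l ?lee_fin ?invr_ge0 ?exprn_ge0 ?(ltW del0)//.
  have := @lebesgue_eball R N xs 1 ltr01; rewrite expr1n mul1r => <-.
  by apply: le_measure; rewrite ?inE//; exact: subDsetl.
have -> : S = inv @^-1` (inv @^-1` S).
  by apply/seteqP; split => y; rewrite /= inversionK.
have mIS : measurable (inv @^-1` S) by exact: measurable_inversion_preimage.
rewrite ge0_integral_inversion_set//.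
have SE z : (inv @^-1` S) z -> [/\ z != x0, shell (d / 2) (2 * D) z, eball x 1 z & ~ U z].
  move=> [/= izd nUs]; have [] := near x (inv z) xS izd; rewrite inversionK// => zS z1.
  have zx0 : z != x0 by apply: shell_neq zS; rewrite divr_gt0.
  split => // Uz; apply: nUs; rewrite /Us inversion_setE//=; split; rewrite ?inversionK//.
  exact/eqP.
have xS2 : shell (d / 2) (2 * D) x.
  by case/andP: xS => h1 h2; apply/andP; split; lra.
apply: (@le_trans _ _ (\int[mu]_(z in inv @^-1` S)
    ((enorm (x - z) ^- N)%:E + K%:E * (potential x z)%:E))%E).
  have mp : measurable_fun setT (fun z => (potential x z)%:E).
    by apply/measurable_EFinP; exact: measurable_potential.
  apply: ge0_le_integral => //.
  - by move=> z _; rewrite mule_ge0// lee_fin inversion_jacobian_ge0.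
  - apply: measurable_funTS; apply: emeasurable_funM.
      exact: (measurableT_comp (mk xs) (measurable_inversion _ _)).
    by apply/measurable_EFinP; exact: measurable_inversion_jacobian.
  - by apply: measurable_funTS; apply: emeasurable_funD => //; exact: measurable_funeM.
  move=> z /SE[zx0 zS _ _]; rewrite -!EFinM -EFinD lee_fin enormVn_inversion//.
  rewrite (_ : enorm (x - z) ^- N + _ = (1 + K * enorm (x - z)) * enorm (x - z) ^- N); last first.
    by rewrite /potential; ring.
  rewrite ler_wpM2r ?enormVn_ge0//.
  have a0 : 0 < enorm (x - x0) by rewrite enormB_gt0.
  have aN : 0 < enorm (x - x0) ^+ N by rewrite exprn_gt0.
  have -> : enorm (x - x0) ^+ N * enorm (z - x0) ^- N = 1 +
     enorm (x - x0) ^+ N * (enorm (z - x0) ^- N - enorm (x - x0) ^- N).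
    by field; rewrite !gt_eqF ?exprn_gt0 ?enormB_gt0.
  rewrite lerD2l /K -mulrA; apply: (@le_trans _ _ (enorm (x - x0) ^+ N *
      `|enorm (z - x0) ^- N - enorm (x - x0) ^- N|)).
    by rewrite ler_wpM2l ?ler_norm// ltW.
  apply: ler_pM => //; first exact: ltW.
    by rewrite lerXn2r ?nnegrE ?(ltW a0) ?(ltW D0)//; case/andP: xS.
  rewrite (le_trans (normr_subVXn_le N _ zS xS2)) ?divr_gt0// ler_wpM2l ?(enormC x z) ?enorm_dist//.
  by rewrite !mulr_ge0// ?invr_ge0 ?exprn_ge0 ?mulr_ge0 ?divr_ge0 ?(ltW D0) ?(ltW d0).
have mp : measurable_fun setT (fun z => (potential x z)%:E).
  by apply/measurable_EFinP; exact: measurable_potential.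
have p0 z : (0 <= (potential x z)%:E)%E by rewrite lee_fin potential_ge0.
rewrite ge0_integralD//; last 3 first.
- exact: measurable_funTS.
- by move=> z _; rewrite mule_ge0.
- by apply: measurable_funTS; exact: measurable_funeM.
rewrite leeD//.
  apply: ge0_subset_integral => //; [exact: measurableD|exact: measurable_funTS|].
  by move=> z /SE[].
rewrite ge0_integralZl//; last exact: measurable_funTS.
rewrite [leRHS]EFinM lee_wpmul2l// (le_trans _ (pC1 x))//.
apply: ge0_subset_integral => //; first exact: measurable_funTS.
by move=> z /SE[].
Qed.

End h_inversion.

Section h_difference.
Context {R : realType} {N : nat}.
Variables (x0 : 'rV[R]_N) (r : R).
Hypotheses (N_gt0 : (0 < N)%N) (r_gt0 : 0 < r).
Local Notation mu := (lebesgue_rV N).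
Local Notation inv := (inversion x0 r).
Local Notation shell := (shell x0).
Implicit Types (x y z : 'rV[R]_N) (u : 'rV[R]_N -> R) (U : set 'rV[R]_N).

(** The far parts of the two [h_] are dropped or bounded by a volume, and
    [integral_outside_inversion_le] compares the near parts. *)
Lemma h_inversion_le d D U : 0 < d -> d <= D -> measurable U -> U `<=` shell d D ->
  exists C, forall x, shell d D x -> h_defined U x ->
  h_defined (inversion_set x0 r U) (inv x) ->
  \int[mu]_(y in eball (inv x) 1 `\` inversion_set x0 r U) (enorm (inv x - y) ^- N)
  - \int[mu]_(y in inversion_set x0 r U `\` eball (inv x) 1) (enorm (inv x - y) ^- N)
  <= \int[mu]_(y in eball x 1 `\` U) (enorm (x - y) ^- N)
     - \int[mu]_(y in U `\` eball x 1) (enorm (x - y) ^- N) + C.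
Proof.
move=> d0 dD mU US.
have [C C0 HC] := @integral_outside_inversion_le _ _ x0 r N_gt0 r_gt0 d D U d0 dD mU.
have Uoo : (mu U < +oo)%E := shell_lty mU US.
exists (C + fine (mu U)) => x xS [i1 i2] [j1 j2].
have mB y e : measurable (eball y e : set 'rV[R]_N) by exact: measurable_eball.
have Q0 : 0 <= \int[mu]_(y in inversion_set x0 r U `\` eball (inv x) 1)
    (enorm (inv x - y) ^- N).
  by apply: Rintegral_ge0 => y _; exact: enormVn_ge0.
have H1 := HC x xS.
have : \int[mu]_(y in eball (inv x) 1 `\` inversion_set x0 r U) (enorm (inv x - y) ^- N)
   <= \int[mu]_(y in eball x 1 `\` U) (enorm (x - y) ^- N) + C.
  rewrite -lee_fin EFinD /Rintegral !fineK//.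
    by apply: integrable_fin_num => //; exact: measurableD.
  apply: integrable_fin_num => //; apply: measurableD => //.
  exact: measurable_inversion_set.
have : \int[mu]_(y in U `\` eball x 1) (enorm (x - y) ^- N) <= fine (mu U).
  rewrite -lee_fin /Rintegral fineK; last first.
    by apply: integrable_fin_num => //; exact: measurableD.
  rewrite fineK ?ge0_fin_numE//.
  apply: (@le_trans _ _ (\int[mu]_(y in U `\` eball x 1) 1)%E).
    apply: ge0_le_integral => //.
    - exact: measurableD.
    - by move=> y _; rewrite lee_fin enormVn_ge0.
    - by apply: measurable_funTS; apply/measurable_EFinP; exact: measurable_enormVn.
    move=> y [_ /negP]; rewrite -leNgt enormC => y1.
    by rewrite lee_fin (le_trans (enormVn_le ltr01 y1))// expr1n invr1.
  rewrite integral_cst ?mul1e; last exact: measurableD.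
  by apply: le_measure; rewrite ?inE//; exact: measurableD.
by move: Q0; lra.
Qed.

(** The inversion is an involution that exchanges [U] with its image and shells
    with shells, so [h_inversion_le] applied to both gives both inequalities. *)
Lemma h_inversion_bounded d D U : 0 < d -> d <= D -> open U -> U `<=` shell d D ->
  exists C, forall x, U x -> `|h_ (inversion_set x0 r U) (inv x) - h_ U x| <= C.
Proof.
move=> d0 dD oU US; have D0 : 0 < D by exact: lt_le_trans dD.
have r2 : 0 < r ^+ 2 by rewrite exprn_gt0.
have mU := measurable_open oU.
have oUs := @open_inversion_set _ _ x0 r r_gt0 U oU; have mUs := measurable_open oUs.
have UsS := @shell_inversion_set _ _ x0 r r_gt0 d D U d0 US.
have nU : ~ U x0 by move=> /US /(shell_neq d0); rewrite eqxx.
have [C1 H1] := h_inversion_le d0 dD mU US.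
have [||C2 H2] := h_inversion_le _ _ mUs UsS; first exact: divr_gt0.
  by rewrite ler_pM2l// lef_pV2.
exists (`|c_ N| * (`|C1| + `|C2|)) => x Ux.
have [e e0 eU] := (openE_eball U).1 oU x Ux.
have ixUs : inversion_set x0 r U (inv x).
  by exists x => //; split => // /= xx0; apply: nU; rewrite -xx0.
have [e' e'0 eUs] := (openE_eball _).1 oUs _ ixUs.
have hU := h_defined_interior mU (shell_lty mU US) e0 eU.
have hUs := h_defined_interior mUs (shell_lty mUs UsS) e'0 eUs.
have := H1 x (US x Ux) hU hUs; have := H2 (inv x) (UsS _ ixUs) hUs.
rewrite inversionK// inversion_setK// => /(_ hU).
rewrite /h_ -mulrBr normrM.
set P := _ - _; set Q := _ - _ => QP PQ.
apply: ler_wpM2l => //; rewrite ler_norml.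
have := ler_norm C1; have := ler_norm C2; have := normr_ge0 C1; have := normr_ge0 C2.
by move=> *; apply/andP; split; lra.
Qed.

End h_difference.

Section measurable_log_laplacian.
Context {R : realType} {N : nat}.
Local Notation mu := (lebesgue_rV N).
Implicit Types (x y z : 'rV[R]_N) (u : 'rV[R]_N -> R).

(** A real-valued integral is [fine] of a difference of two Tonelli integrals;
    it is measurable in the parameter whether or not it converges. *)
Lemma measurable_Rintegral_param (G : 'rV[R]_N * 'rV[R]_N -> R) :
  measurable_fun setT G -> measurable_fun setT (fun x => \int[mu]_y G (x, y)).
Proof.
move=> mG; apply: measurableT_comp => //.
under eq_fun do rewrite integralE.
have mEG : measurable_fun setT (EFin \o G) by exact/measurable_EFinP.
apply: emeasurable_funB.
- have -> : (fun x => \int[mu]_y ((fun y => (G (x, y))%:E)^\+ y))%E =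
      (fun x => \int[mu]_y ((EFin \o G)^\+ (x, y)))%E.
    by apply/funext => x; apply: eq_integral => y _; rewrite !funeposE.
  apply: (measurable_fun_fubini_tonelli_F ((EFin \o G)^\+)%E) => //.
  exact: measurable_funepos.
- have -> : (fun x => \int[mu]_y ((fun y => (G (x, y))%:E)^\- y))%E =
      (fun x => \int[mu]_y ((EFin \o G)^\- (x, y)))%E.
    by apply/funext => x; apply: eq_integral => y _; rewrite !funenegE.
  apply: (measurable_fun_fubini_tonelli_F ((EFin \o G)^\-)%E) => //.
  exact: measurable_funeneg.
Qed.

Lemma measurable_loglap u : measurable_fun setT u -> measurable_fun setT (loglap u).
Proof.
move=> mfu; pose E : set ('rV[R]_N * 'rV[R]_N) := [set p | enorm (p.2 - p.1) < 1].
have md : measurable_fun setT (fun p : 'rV[R]_N * 'rV[R]_N => enorm (p.1 - p.2)).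
  by apply: measurable_enorm; exact: measurable_rVB.
have mE : measurable E.
  rewrite [E](_ : _ = (fun p => enorm (p.1 - p.2)) @^-1` `]-oo, 1[%classic).
    by rewrite -[X in measurable X]setTI; exact: md.
  by apply/seteqP; split => p; rewrite /E/= in_itv/= enormC.
have mdV : measurable_fun setT (fun p : 'rV[R]_N * 'rV[R]_N => (enorm (p.1 - p.2) ^+ N)^-1).
  by apply: measurable_funV; exact: measurable_funX.
have m1 : measurable_fun setT (u \o @fst 'rV[R]_N 'rV[R]_N) by exact: measurableT_comp.
have m2 : measurable_fun setT (u \o @snd 'rV[R]_N 'rV[R]_N) by exact: measurableT_comp.
rewrite /loglap; apply: measurable_funD; last exact: measurable_funM.
apply: measurable_funB; apply: measurable_funM => //.
- pose G (p : 'rV[R]_N * 'rV[R]_N) := (u p.1 - u p.2) / enorm (p.1 - p.2) ^+ N * \1_E p.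
  rewrite (_ : (fun x => _) = fun x => \int[mu]_y G (x, y)).
    apply: measurable_Rintegral_param; apply: measurable_funM => //.
    by apply: measurable_funM => //; exact: measurable_funB.
  apply/funext => x; rewrite Rintegral_mkcond; apply: eq_Rintegral => y _.
  rewrite patchE /G indicE (_ : (_ \in E) = (y \in eball x 1)); last first.
    by apply/idP/idP; rewrite !inE.
  by case: ifP => _; rewrite ?mulr1 ?mulr0.
- pose G (p : 'rV[R]_N * 'rV[R]_N) := u p.2 / enorm (p.1 - p.2) ^+ N * \1_(~` E) p.
  rewrite (_ : (fun x => _) = fun x => \int[mu]_y G (x, y)).
    apply: measurable_Rintegral_param; apply: measurable_funM; first exact: measurable_funM.
    by apply: measurable_indic; exact: measurableC.
  apply/funext => x; rewrite Rintegral_mkcond; apply: eq_Rintegral => y _.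
  rewrite patchE /G indicE (_ : (_ \in ~` E) = (y \in ~` eball x 1)); last first.
    by apply/idP/idP; rewrite !inE.
  by case: ifP => _; rewrite ?mulr1 ?mulr0.
Qed.

End measurable_log_laplacian.

(** * Essentially bounded functions *)

Section essentially_bounded.
Context {R : realType} {N : nat}.
Local Notation mu := (lebesgue_rV N).
Implicit Types (f : 'rV[R]_N -> R) (U : set 'rV[R]_N).

Lemma in_Linfty_bound U f : in_Linfty U f ->
  exists2 C, 0 <= C & {ae mu, forall x, U x -> `|f x| <= C}.
Proof.
rewrite /in_Linfty inE => /andP[_]; rewrite inE/= /finite_norm unlock.
have [mu0|mu0] := ltP 0%E (mu setT) => fin.
  have [C HC] := ess_supr_bounded fin.
  exists `|C| => //; apply: filterS HC => x /=.
  by rewrite patchE => + Ux; rewrite mem_set// => /le_trans; apply; exact: ler_norm.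
exists 0 => //; exists setT; split => //.
by apply/eqP; rewrite eq_le mu0 measure_ge0.
Qed.

Lemma in_Linfty_of_bound U f C : measurable U -> measurable_fun setT f ->
  {ae mu, forall x, U x -> `|f x| <= C} -> in_Linfty U f.
Proof.
move=> mU mf fC; have mfU : measurable_fun setT (f \_ U).
  exact: ((measurable_restrictT _ mU).1 (measurable_funTS mf)).
rewrite /in_Linfty inE; apply/andP; split; rewrite inE//= /finite_norm unlock.
case: ifPn => // _; apply: (@le_lt_trans _ _ `|C|%:E); last exact: ltry.
apply/ess_supP; apply: filterS fC => x fC; rewrite /= lee_fin patchE.
case: ifPn => [|_]; last by rewrite normr0.
by rewrite inE => /fC /le_trans; apply; exact: ler_norm.
Qed.

End essentially_bounded.

Section kelvin_Linfty.
Context {R : realType} {N : nat}.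
Variables (x0 : 'rV[R]_N) (r : R).
Hypotheses (N_gt0 : (0 < N)%N) (r_gt0 : 0 < r).
Local Notation mu := (lebesgue_rV N).
Local Notation inv := (inversion x0 r).
Local Notation shell := (shell x0).
Implicit Types (x y z : 'rV[R]_N) (u : 'rV[R]_N -> R) (U : set 'rV[R]_N).

(** The inverse image of a null set is null by the change of variables. *)
Lemma ae_inversion (P : 'rV[R]_N -> Prop) :
  {ae mu, forall x, P x} -> {ae mu, forall y, P (inv y)}.
Proof.
move=> [A [mA A0 PA]]; exists (inv @^-1` A); split.
- exact: measurable_inversion_preimage.
- have mi : measurable (inv @^-1` A) by exact: measurable_inversion_preimage.
  rewrite -[LHS]mul1e -integral_cst// ge0_integral_inversion_set//.
  apply: null_set_integral => //.
  under eq_fun do rewrite mul1e; apply/measurable_EFinP.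
  exact: measurable_funTS (measurable_inversion_jacobian _ _).
- by move=> y nPy; apply: PA.
Qed.

(** As [U] stays away from the centre and from infinity, the factors of the
    transformation formula are bounded, and so is the difference of the two
    functions [h_], although each of them blows up at the boundary. *)
Theorem kelvin_Linfty d D U u : 0 < d -> d <= D -> open U -> U `<=` shell d D ->
  measurable_fun setT u -> (forall y, ~ U y -> u y = 0) ->
  in_Linfty U u -> {ae mu, forall x, U x -> loglap_defined u x} ->
  in_Linfty U (loglap u) ->
  [/\ in_Linfty (inversion_set x0 r U) (kelvin x0 r u),
      {ae mu, forall x, inversion_set x0 r U x -> loglap_defined (kelvin x0 r u) x} &
      in_Linfty (inversion_set x0 r U) (loglap (kelvin x0 r u))].
Proof.
move=> d0 dD oU US mfu u_out /in_Linfty_bound[C C0 uC] lu /in_Linfty_bound[C' C'0 luC].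
set us := kelvin x0 r u; set Us := inversion_set x0 r U.
have D0 : 0 < D by exact: lt_le_trans dD.
have mU := measurable_open oU.
have oUs := @open_inversion_set _ _ x0 r r_gt0 U oU; have mUs := measurable_open oUs.
have UsS := @shell_inversion_set _ _ x0 r r_gt0 d D U d0 US.
have mus : measurable_fun setT us by exact: measurable_kelvin.
have UsE y : Us y -> exists x, [/\ U x, x != x0, shell d D x, inv y = x & y = inv x].
  move=> [x [Ux xx0] <-]; exists x; split => //; [exact/eqP|exact: US|by rewrite inversionK].
pose al := (D / r ^+ 2) ^+ N.
have al0 : 0 <= al by rewrite exprn_ge0// divr_ge0 ?exprn_ge0 ?ltW.
have alE x : shell d D x -> 0 <= enorm (inv x - x0) ^- N <= al.
  move=> xS; have xx0 := shell_neq d0 xS.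
  rewrite enormVn_ge0/= /al enorm_inversionB// -exprVn invf_div.
  have a0 : 0 < enorm (x - x0) by rewrite enormB_gt0.
  rewrite lerXn2r ?nnegrE ?divr_ge0 ?exprn_ge0 ?(ltW D0) ?enorm_ge0 ?(ltW r_gt0)//.
  by rewrite ler_wpM2r ?invr_ge0 ?exprn_ge0 ?(ltW r_gt0)//; case/andP: xS.
have uC' := ae_inversion uC; have luC' := ae_inversion luC; have lu' := ae_inversion lu.
have [K HK] := Rintegral_kelvin_kernel_le N_gt0 d0 D0 mU US.
have [H HH] := h_inversion_bounded N_gt0 r_gt0 d0 dD oU US.
have formula y : Us y -> loglap_defined u (inv y) ->
    loglap_defined us y /\ loglap us y =
    enorm (y - x0) ^- N * loglap u (inv y)
    + c_ N * r ^+ (2 * N) * enorm (y - x0) ^- (2 * N) * u (inv y) *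
      \int[mu]_(z in U) kelvin_kernel x0 (inv y) z
    + (h_ Us y - h_ U (inv y)) * enorm (y - x0) ^- N * u (inv y).
  move=> Usy; have [x [Ux xx0 xS -> yx]] := UsE y Usy; rewrite yx => lx.
  apply: kelvin_loglap => //.
  move=> _; split.
  - have [e e0 eU] := (openE_eball U).1 oU x Ux.
    exact: h_defined_interior mU (shell_lty mU US) e0 eU.
  - rewrite -yx; have [e e0 eU] := (openE_eball Us).1 oUs y Usy.
    exact: h_defined_interior mUs (shell_lty mUs UsS) e0 eU.
  - exact: integrable_kelvin_kernel US xS.
split.
- apply: (@in_Linfty_of_bound _ _ _ _ (al * C)) => //.
  apply: filterS uC' => y uCy Usy.
  have [x [Ux xx0 xS iyx yx]] := UsE y Usy.
  rewrite /us yx kelvin_inversion// normrM; rewrite iyx in uCy.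
  have /andP[a0 aal] := alE x xS.
  by apply: ler_pM => //; [rewrite ger0_norm|exact: uCy].
- apply: filterS lu' => y luy Usy; apply: (formula y Usy _).1.
  have [x [Ux _ _ iyx _]] := UsE y Usy; rewrite iyx in luy *; exact: luy.
- apply: (@in_Linfty_of_bound _ _ _ _ (al * C' +
    `|c_ N| * r ^+ (2 * N) * al ^+ 2 * C * `|K| + `|H| * al * C)) => //.
    exact: measurable_loglap.
  apply: filterS3 uC' luC' lu' => y uCy luCy luy Usy.
  have [x [Ux xx0 xS iyx yx]] := UsE y Usy.
  rewrite iyx in uCy luCy luy.
  have [_ ->] := formula y Usy ltac:(by rewrite iyx; exact: luy).
  rewrite iyx; have /andP[a0 aal] := alE x xS; rewrite -yx in a0 aal.
  have uxC := uCy Ux; have lxC := luCy Ux.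
  have KC : `|\int[mu]_(z in U) kelvin_kernel x0 x z| <= `|K|.
    exact: le_trans (HK x xS) (ler_norm _).
  have HC : `|h_ Us y - h_ U x| <= `|H|.
    by rewrite yx; exact: le_trans (HH x Ux) (ler_norm _).
  rewrite (le_trans (ler_normD _ _))// lerD//.
    rewrite (le_trans (ler_normD _ _))// lerD//.
      by rewrite normrM ler_pM// ger0_norm.
    rewrite !normrM (ger0_norm (exprn_ge0 (2 * N) (ltW r_gt0))).
    apply: ler_pM => //; first by rewrite !mulr_ge0// exprn_ge0// ltW.
    apply: ler_pM => //; first by rewrite !mulr_ge0// exprn_ge0// ltW.
    rewrite ler_wpM2l// ?mulr_ge0// ?exprn_ge0 ?(ltW r_gt0)//.
    rewrite (mulnC 2%N) exprM -exprVn ger0_norm ?exprn_ge0//.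
    by rewrite lerXn2r ?nnegrE.
  rewrite !normrM; apply: ler_pM => //; apply: ler_pM => //.
  by rewrite ger0_norm.
Qed.

End kelvin_Linfty.

(** * The energy space *)

Section square_integrable.
Context {R : realType} {N : nat}.
Local Notation mu := (lebesgue_rV N).
Implicit Types (f : 'rV[R]_N -> R).

Lemma Lfun2P f : f \in Lfun mu 2%:E <->
  measurable_fun setT f /\ (\int[mu]_x (f x ^+ 2)%:E < +oo)%E.
Proof.
split=> [f2|[mf f2]].
  have := Lfun2_integrable_sqr f2 => /integrableP[_ i2]; split.
    by move: f2; rewrite inE => /andP[]; rewrite inE.
  apply: le_lt_trans i2; rewrite le_eqVlt; apply/orP; left; apply/eqP.
  by apply: eq_integral => x _ /=; rewrite ger0_norm// sqr_ge0.
rewrite inE; apply/andP; split; rewrite inE//= /finite_norm unlock poweR_lty//.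
apply: le_lt_trans f2; rewrite le_eqVlt; apply/orP; left; apply/eqP.
apply: eq_integral => x _ /=; congr EFin.
by rewrite powR_mulrn// real_normK// num_real.
Qed.

(** Schur's test for a symmetric kernel: Tonelli in the order that leaves the
    variable of [g] for last. *)
Lemma schur_test (g : 'rV[R]_N -> R) (k : 'rV[R]_N * 'rV[R]_N -> R) C :
  measurable_fun setT g -> (forall x, 0 <= g x) ->
  measurable_fun setT k -> (forall p, 0 <= k p) ->
  (forall x z, k (x, z) = k (z, x)) -> 0 <= C ->
  (forall x, \int[mu]_z (k (x, z))%:E <= C%:E)%E ->
  (\int[mu \x mu]_p ((g p.1 + g p.2) * k p)%:E <= (C + C)%:E * \int[mu]_x (g x)%:E)%E.
Proof.
move=> mg g0 mk k0 ksym C0 kC.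
pose F1 p : \bar R := (g p.1 * k p)%:E; pose F2 p : \bar R := (g p.2 * k p)%:E.
have mF1 : measurable_fun setT F1.
  by apply/measurable_EFinP; apply: measurable_funM => //; exact: measurableT_comp.
have mF2 : measurable_fun setT F2.
  by apply/measurable_EFinP; apply: measurable_funM => //; exact: measurableT_comp.
have F10 p : (0 <= F1 p)%E by rewrite lee_fin mulr_ge0.
have F20 p : (0 <= F2 p)%E by rewrite lee_fin mulr_ge0.
have mgE : measurable_fun setT (fun x => (g x)%:E) by exact/measurable_EFinP.
have g0E x : (0 <= (g x)%:E)%E by rewrite lee_fin.
have mkx x : measurable_fun setT (fun z => (k (x, z))%:E).
  by apply/measurable_EFinP; apply: (measurableT_comp mk); exact: pair1_measurable.
have B1 : (\int[mu]_x \int[mu]_z F1 (x, z) <= C%:E * \int[mu]_x (g x)%:E)%E.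
  rewrite -ge0_integralZl//; apply: ge0_le_integral => //.
  - by move=> x _; exact: integral_ge0.
  - exact: measurable_fun_fubini_tonelli_F.
  - exact: measurable_funeM.
  move=> x _; rewrite /F1 [leRHS]muleC.
  under eq_integral do rewrite /= EFinM.
  rewrite ge0_integralZl//; first by rewrite lee_wpmul2l.
  by move=> z _; rewrite lee_fin.
have -> : (\int[mu \x mu]_p ((g p.1 + g p.2) * k p)%:E =
    \int[mu \x mu]_p F1 p + \int[mu \x mu]_p F2 p)%E.
  by rewrite -ge0_integralD//; apply: eq_integral => p _; rewrite mulrDl EFinD.
rewrite fubini_tonelli1// fubini_tonelli2// EFinD ge0_muleDl ?lee_fin//.
rewrite leeD//; apply: le_trans B1; rewrite le_eqVlt; apply/orP; left; apply/eqP.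
by apply: eq_integral => x _; apply: eq_integral => z _; rewrite /F1 /F2 /= ksym.
Qed.

End square_integrable.

Section kelvin_H.
Context {R : realType} {N : nat}.
Variables (x0 : 'rV[R]_N) (r : R).
Hypotheses (N_gt0 : (0 < N)%N) (r_gt0 : 0 < r).
Local Notation mu := (lebesgue_rV N).
Local Notation inv := (inversion x0 r).
Local Notation J := (inversion_jacobian x0 r).
Local Notation shell := (shell x0).
Implicit Types (x y z : 'rV[R]_N) (u : 'rV[R]_N -> R) (U : set 'rV[R]_N).

Lemma integral2_inversion (F : 'rV[R]_N * 'rV[R]_N -> \bar R) :
  measurable_fun setT F -> (forall p, 0 <= F p)%E ->
  (\int[mu \x mu]_p F p =
   \int[mu \x mu]_p (F (inv p.1, inv p.2) * (J p.1 * J p.2)%:E))%E.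
Proof.
move=> mF F0.
have mi : measurable_fun setT inv by exact: measurable_inversion.
have mJ : measurable_fun setT (fun x => (J x)%:E).
  by apply/measurable_EFinP; exact: measurable_inversion_jacobian.
have J0 x : (0 <= (J x)%:E)%E by rewrite lee_fin inversion_jacobian_ge0.
rewrite fubini_tonelli1// [RHS]fubini_tonelli1; first last.
- by move=> p; rewrite mule_ge0// lee_fin mulr_ge0// inversion_jacobian_ge0.
- apply: emeasurable_funM.
    apply: (measurableT_comp mF); apply: measurable_fun_pair.
      exact: (measurableT_comp mi).
    exact: (measurableT_comp mi).
  apply/measurable_EFinP; apply: measurable_funM.
    exact: (measurableT_comp (measurable_inversion_jacobian x0 r)).
  exact: (measurableT_comp (measurable_inversion_jacobian x0 r)).
rewrite /fubini_F -(@ge0_integral_inversion _ _ x0 r)//; last 2 first.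
- exact: measurable_fun_fubini_tonelli_F.
- by move=> x; exact: integral_ge0.
apply: eq_integral => x _ /=.
have mFx y : measurable_fun setT (fun z => F (y, z)).
  by apply: (measurableT_comp mF); exact: pair1_measurable.
rewrite -(@ge0_integral_inversion _ _ x0 r)// -ge0_integralZr//; last 2 first.
- by apply: emeasurable_funM => //; exact: (measurableT_comp (mFx _)).
- by move=> z _; rewrite mule_ge0.
by apply: eq_integral => z _; rewrite EFinM -muleA [((J x)%:E * _)%E]muleC.
Qed.

Definition sq_quotient u (p : 'rV[R]_N * 'rV[R]_N) : R :=
  `|u p.1 - u p.2| ^+ 2 / enorm (p.1 - p.2) ^+ N.

Lemma sq_quotient_ge0 u p : 0 <= sq_quotient u p.
Proof. by rewrite mulr_ge0// enormVn_ge0. Qed.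

Lemma measurable_sq_quotient u : measurable_fun setT u ->
  measurable_fun setT (sq_quotient u).
Proof.
move=> mfu; apply: measurable_funM; last first.
  apply: measurable_funV; apply: measurable_funX.
  by apply: measurable_enorm; exact: measurable_rVB.
apply: measurable_funX; apply: measurableT_comp => //.
by apply: measurable_funB; exact: measurableT_comp.
Qed.

(** The square of the Kelvin weight is the inverse of the Jacobian, up to a
    constant: the transform is an isometry of square-integrable functions up to
    a factor. *)
Lemma kelvin_sqr u z : z != x0 ->
  kelvin x0 r u (inv z) ^+ 2 * J z = r ^- (2 * N) * u z ^+ 2.
Proof.
move=> zx0; rewrite kelvin_inversion// enorm_inversionB// /inversion_jacobian.
rewrite !(mulnC 2%N) !exprM !(expr_div_n, exprMn) !exprVn !(expr_div_n, exprMn).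
have : 0 < enorm (z - x0) ^+ N by rewrite exprn_gt0// enormB_gt0.
have : 0 < r ^+ N by rewrite exprn_gt0.
move: (enorm (z - x0) ^+ N) (r ^+ N) => b s s0 b0.
by field; rewrite !gt_eqF.
Qed.

(** The near-diagonal part of the energy: the weights are comparable to
    constants, and their variation costs the square of the distance, of which
    one power makes the kernel integrable. *)
Lemma sq_quotient_kelvin_le d D : 0 < d -> exists2 C, 0 <= C & forall u x z,
  shell d D x -> shell d D z -> enorm (x - z) <= 1 ->
  sq_quotient (kelvin x0 r u) (inv x, inv z) * (J x * J z) <=
  C * (sq_quotient u (x, z) + u z ^+ 2 * potential x z).
Proof.
move=> d0; pose K := N%:R * D ^+ N.-1.
pose A := r ^- (2 * N) * (d ^+ N * d ^+ N)^-1.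
have A0 : 0 <= A.
  by rewrite mulr_ge0// invr_ge0 ?mulr_ge0// exprn_ge0// ltW.
have C0 : 0 <= A * (2 * (D ^+ N) ^+ 2 + 2 * K ^+ 2).
  by rewrite mulr_ge0// addr_ge0// mulr_ge0// sqr_ge0.
exists (A * (2 * (D ^+ N) ^+ 2 + 2 * K ^+ 2)) => //.
move=> u x z xS zS xz1.
have xx0 := shell_neq d0 xS; have zx0 := shell_neq d0 zS.
have [->|xz] := eqVneq x z.
  rewrite {1}/sq_quotient /= subrr normr0 expr0n !mul0r mulr_ge0//.
  by rewrite addr_ge0 ?sq_quotient_ge0// mulr_ge0 ?sqr_ge0 ?potential_ge0.
set a := enorm (x - x0); set b := enorm (z - x0); set e := enorm (x - z) in xz1 *.
have a0 : 0 < a by rewrite /a enormB_gt0.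
have b0 : 0 < b by rewrite /b enormB_gt0.
have e0 : 0 < e by rewrite /e enormB_gt0.
have [da aD] : d <= a /\ a <= D by case/andP: xS.
have [db bD] : d <= b /\ b <= D by case/andP: zS.
have D0 : 0 < D by exact: lt_le_trans aD.
have -> : sq_quotient (kelvin x0 r u) (inv x, inv z) * (J x * J z) =
    r ^- (2 * N) * (a ^+ N * b ^+ N)^-1 * e ^- N * (a ^+ N * u x - b ^+ N * u z) ^+ 2.
  rewrite /sq_quotient /= real_normK ?num_real// !kelvin_inversion//.
  rewrite enorm_inversion_sub// !enorm_inversionB// /inversion_jacobian -/a -/b -/e.
  rewrite !(mulnC 2%N) !exprM !(expr_div_n, exprMn).
  have := exprn_gt0 N a0; have := exprn_gt0 N b0; have := exprn_gt0 N e0; have := exprn_gt0 N r_gt0.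
  move: (a ^+ N) (b ^+ N) (e ^+ N) (r ^+ N) => a' b' e' s s0 e'0 b'0 a'0.
  by field; rewrite !gt_eqF.
have q0 := sq_quotient_ge0 u (x, z).
have pE : sq_quotient u (x, z) = (u x - u z) ^+ 2 * e ^- N.
  by rewrite /sq_quotient /= real_normK ?num_real.
have aN : a ^+ N <= D ^+ N by rewrite lerXn2r ?nnegrE ?(ltW a0) ?(ltW D0).
have aN0 := exprn_gt0 N a0; have bN0 := exprn_gt0 N b0; have eN0 := exprn_gt0 N e0.
have eV0 : 0 <= e ^- N by rewrite invr_ge0 ltW.
have K0 : 0 <= K by rewrite mulr_ge0// exprn_ge0// ltW.
have abK : `|a ^+ N - b ^+ N| <= K * e.
  rewrite (le_trans (@normr_subXn_le _ N a b D _ _)) ?(ltW a0) ?(ltW b0)//.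
  by rewrite ler_wpM2l// enorm_dist.
have H1 : (a ^+ N * u x - b ^+ N * u z) ^+ 2 <=
    2 * (D ^+ N) ^+ 2 * (u x - u z) ^+ 2 + 2 * K ^+ 2 * e * u z ^+ 2.
  have -> : a ^+ N * u x - b ^+ N * u z =
     a ^+ N * (u x - u z) + (a ^+ N - b ^+ N) * u z by ring.
  have h1 : (a ^+ N * (u x - u z)) ^+ 2 <= (D ^+ N) ^+ 2 * (u x - u z) ^+ 2.
    by rewrite exprMn ler_wpM2r ?sqr_ge0// lerXn2r ?nnegrE ?(ltW aN0) ?exprn_ge0 ?(ltW D0).
  have h2 : ((a ^+ N - b ^+ N) * u z) ^+ 2 <= K ^+ 2 * e * u z ^+ 2.
    rewrite exprMn ler_wpM2r ?sqr_ge0// -real_normK ?num_real//.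
    apply: (@le_trans _ _ ((K * e) ^+ 2)).
      by rewrite lerXn2r ?nnegrE ?(mulr_ge0 K0 (ltW e0)).
    by rewrite exprMn ler_wpM2l ?sqr_ge0// expr2 ler_piMl// ltW.
  move: h1 h2; move: (a ^+ N * (u x - u z)) ((a ^+ N - b ^+ N) * u z) => s t.
  by move=> h1 h2; have := sqr_ge0 (s - t); nra.
have H2 : r ^- (2 * N) * (a ^+ N * b ^+ N)^-1 <= A.
  rewrite /A ler_wpM2l ?invr_ge0 ?exprn_ge0 ?(ltW r_gt0)//.
  rewrite lef_pV2 ?posrE ?mulr_gt0 ?exprn_gt0//.
  by apply: ler_pM; rewrite ?exprn_ge0 ?(ltW d0)// lerXn2r ?nnegrE ?(ltW d0) ?(ltW a0) ?(ltW b0).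
rewrite -[A * _ * _]mulrA -[X in X <= _]mulrA.
apply: ler_pM => //.
- by rewrite mulr_ge0// invr_ge0 ?mulr_ge0 ?(ltW aN0) ?(ltW bN0)// exprn_ge0// ltW.
- by rewrite mulr_ge0// sqr_ge0.
apply: (@le_trans _ _ (e ^- N * (2 * (D ^+ N) ^+ 2 * (u x - u z) ^+ 2 +
    2 * K ^+ 2 * e * u z ^+ 2))); first by rewrite ler_wpM2l.
rewrite pE /potential -/e.
set X := (u x - u z) ^+ 2 * e ^- N; set Y := u z ^+ 2 * (e / e ^+ N).
have X0 : 0 <= X by rewrite mulr_ge0// sqr_ge0.
have Y0 : 0 <= Y by rewrite mulr_ge0 ?sqr_ge0// mulr_ge0// ltW.
have -> : e ^- N * (2 * (D ^+ N) ^+ 2 * (u x - u z) ^+ 2 + 2 * K ^+ 2 * e * u z ^+ 2) =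
   2 * (D ^+ N) ^+ 2 * X + 2 * K ^+ 2 * Y by rewrite /X /Y; ring.
have := sqr_ge0 (D ^+ N); have := sqr_ge0 K; move: ((D ^+ N) ^+ 2) (K ^+ 2) => s t.
by nra.
Qed.

End kelvin_H.

Section kelvin_energy.
Context {R : realType} {N : nat}.
Variables (x0 : 'rV[R]_N) (r : R).
Hypotheses (N_gt0 : (0 < N)%N) (r_gt0 : 0 < r).
Local Notation mu := (lebesgue_rV N).
Local Notation inv := (inversion x0 r).
Local Notation J := (inversion_jacobian x0 r).
Local Notation shell := (shell x0).
Implicit Types (x y z : 'rV[R]_N) (u : 'rV[R]_N -> R) (U : set 'rV[R]_N).

Definition near_diagonal (e : R) : set ('rV[R]_N * 'rV[R]_N) :=
  [set p | enorm (p.1 - p.2) < e].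

Lemma measurable_near_diagonal e : measurable (near_diagonal e).
Proof.
rewrite (_ : near_diagonal e = (fun p => enorm (p.1 - p.2)) @^-1` `]-oo, e[%classic).
  rewrite -[X in measurable X]setTI.
  by apply: measurable_enorm => //; exact: measurable_rVB.
by apply/seteqP; split => p; rewrite /near_diagonal/= in_itv/=.
Qed.

Lemma inversion_jacobian_center : J x0 = 0.
Proof. by rewrite /J subrr enorm0 invr0 mulr0 expr0n muln_eq0/= gtn_eqF. Qed.

Lemma kelvin_Lfun2 u : u x0 = 0 -> u \in Lfun mu 2%:E ->
  kelvin x0 r u \in Lfun mu 2%:E.
Proof.
move=> ux0 /Lfun2P[mfu u2]; apply/Lfun2P.
have mus : measurable_fun setT (kelvin x0 r u) by exact: measurable_kelvin.
split=> //; rewrite -(@ge0_integral_inversion _ _ x0 r)//; last 2 first.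
- by apply/measurable_EFinP; exact: measurable_funX.
- by move=> x; rewrite lee_fin sqr_ge0.
rewrite (eq_integral (fun z => (r ^- (2 * N))%:E * (u z ^+ 2)%:E)%E); last first.
  move=> z _; rewrite -!EFinM; congr EFin.
  have [->|zx0] := eqVneq z x0; last exact: kelvin_sqr.
  by rewrite inversion_jacobian_center ux0 expr0n !mulr0.
rewrite ge0_integralZl//; last 3 first.
- by apply/measurable_EFinP; exact: measurable_funX.
- by move=> z _; rewrite lee_fin sqr_ge0.
- by rewrite lee_fin invr_ge0 exprn_ge0// ltW.
by apply: lte_mul_pinfty => //; rewrite lee_fin invr_ge0 exprn_ge0// ltW.
Qed.

(** Pairs at distance at least [del] are controlled by the square norm; for
    closer pairs both points lie in a larger shell as soon as one of them lies
    in the support, and the change of variables is applied to both. *)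
Theorem kelvin_in_H d D U u : 0 < d -> d <= D -> measurable U -> U `<=` shell d D ->
  in_H U u -> in_H (inversion_set x0 r U) (kelvin x0 r u).
Proof.
move=> d0 dD mU US [u2 u_out uH].
have D0 : 0 < D by exact: lt_le_trans dD.
have nU : ~ U x0 by move=> /US /(shell_neq d0); rewrite eqxx.
have us2 := kelvin_Lfun2 (u_out _ nU) u2.
split; [exact: us2|exact: kelvin_out|].
set us := kelvin x0 r u.
have [mfu i2] := (Lfun2P u).1 u2; have [mus is2] := (Lfun2P us).1 us2.
have [del /andP[del0 del1] near] := @near_inversion _ _ x0 r r_gt0 d D d0 dD.
have d2 : 0 < d / 2 by rewrite divr_gt0.
have [C C0 HC] := @sq_quotient_kelvin_le _ _ x0 r r_gt0 (d / 2) (2 * D) d2.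
have [C2 C20 pC2] := integral_potential_le N_gt0 (@ltr01 R).
pose V := unit_ball_volume (R := R) (N := N).
have V0 : 0 <= V by exact: unit_ball_volume_ge0.
pose S : set ('rV[R]_N * 'rV[R]_N) := [set p | enorm (p.1 - p.2) <= 1].
have mdist : measurable_fun setT (fun p : 'rV[R]_N * 'rV[R]_N => enorm (p.1 - p.2)).
  by apply: measurable_enorm; exact: measurable_rVB.
have mS : measurable S.
  rewrite [S](_ : _ = (fun p => enorm (p.1 - p.2)) @^-1` `]-oo, 1%R]%classic).
    by rewrite -[X in measurable X]setTI; exact: mdist.
  by apply/seteqP; split => p; rewrite /S/= in_itv/=.
(* [k1] controls the pairs at distance at least [del], where the energy density
   is at most [del ^- N] times twice the sum of the squares; [k2] carries the
   error term of [sq_quotient_kelvin_le]. *)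
pose k1 (p : 'rV[R]_N * 'rV[R]_N) : R := del ^- N * 2 * \1_(near_diagonal 2) p.
pose k2 (p : 'rV[R]_N * 'rV[R]_N) : R := potential p.1 p.2 * \1_(near_diagonal 1) p.
have delN0 : 0 <= del ^- N * 2 by rewrite mulr_ge0// invr_ge0 exprn_ge0// ltW.
have mk1 : measurable_fun setT k1.
  by apply: measurable_funM => //; apply: measurable_indic; exact: measurable_near_diagonal.
have mk2 : measurable_fun setT k2.
  apply: measurable_funM; last by apply: measurable_indic; exact: measurable_near_diagonal.
  by apply: measurable_funM => //; apply: measurable_funV; exact: measurable_funX.
have k10 p : 0 <= k1 p by rewrite mulr_ge0.
have k20 p : 0 <= k2 p by rewrite mulr_ge0// potential_ge0.
have indC e x z : \1_(near_diagonal e) (x, z) = \1_(near_diagonal e) (z, x) :> R.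
  rewrite !indicE; congr ((_ : bool)%:R).
  by apply/idP/idP; rewrite !inE /near_diagonal/= enormC.
have k1C x z : k1 (x, z) = k1 (z, x) by rewrite /k1 indC.
have k2C x z : k2 (x, z) = k2 (z, x) by rewrite /k2 indC /potential /= enormC.
have ndE e x z : ((x, z) \in near_diagonal e) = (z \in eball x e).
  by apply/idP/idP; rewrite !inE /near_diagonal /eball /= enormC.
have int1 x : (\int[mu]_z (k1 (x, z))%:E <= (del ^- N * 2 * (2 ^+ N * V))%:E)%E.
  rewrite (eq_integral (fun z => (del ^- N * 2)%:E * (\1_(eball x 2) z)%:E)%E); last first.
    by move=> z _; rewrite -EFinM /k1 !indicE ndE.
  have mE : measurable (eball x 2) by exact: measurable_eball.
  rewrite ge0_integralZl//; last first.
    by apply/measurable_EFinP; exact: measurable_indic.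
  by rewrite integral_indic// setIT [leRHS]EFinM -(@lebesgue_eball _ _ x).
have int2 x : (\int[mu]_z (k2 (x, z))%:E <= C2%:E)%E.
  apply: le_trans (pC2 x); rewrite [leRHS]integral_mkcond le_eqVlt; apply/orP; left; apply/eqP.
  apply: eq_integral => z _; rewrite patchE /k2 indicE ndE.
  by case: ifP; rewrite ?mulr1 ?mulr0.
pose g (v : 'rV[R]_N -> R) x : R := v x ^+ 2.
have mg v : measurable_fun setT v -> measurable_fun setT (g v) by move=> mv; exact: measurable_funX.
have g0 v x : 0 <= g v x by exact: sqr_ge0.
have schur1 := schur_test (mg _ mus) (g0 us) mk1 k10 k1C
   (mulr_ge0 delN0 (mulr_ge0 (exprn_ge0 N (ler0n R 2)) V0)) int1.
have schur2 := schur_test (mg _ mfu) (g0 u) mk2 k20 k2C C20 int2.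
pose A1 p : R := (g us p.1 + g us p.2) * k1 p.
pose A2 p : R := (g u p.1 + g u p.2) * k2 p.
have mA v k : measurable_fun setT v -> measurable_fun setT k ->
    measurable_fun setT (fun p : 'rV[R]_N * 'rV[R]_N => ((g v p.1 + g v p.2) * k p)%:E).
  move=> mv mk; apply/measurable_EFinP; apply: measurable_funM => //.
  by apply: measurable_funD; apply: (measurableT_comp (mg _ mv)).
have A10 p : 0 <= A1 p by rewrite mulr_ge0// addr_ge0.
have A20 p : 0 <= A2 p by rewrite mulr_ge0// addr_ge0.
pose B p : \bar R := (sq_quotient us p * \1_(near_diagonal del) p)%:E.
have mB : measurable_fun setT B.
  apply/measurable_EFinP; apply: measurable_funM; first exact: measurable_sq_quotient.
  by apply: measurable_indic; exact: measurable_near_diagonal.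
have B0 p : (0 <= B p)%E by rewrite lee_fin mulr_ge0// sq_quotient_ge0.
have msq (v : 'rV[R]_N -> R) : measurable_fun setT v -> measurable_fun setT (fun p => (sq_quotient v p)%:E).
  by move=> mv; apply/measurable_EFinP; exact: measurable_sq_quotient.
rewrite -[X in (X < _)%E]/(\int[mu \x mu]_(p in S) (sq_quotient us p)%:E)%E.
apply: (@le_lt_trans _ _ (\int[mu \x mu]_p ((A1 p)%:E + B p))%E).
  rewrite integral_mkcond; apply: ge0_le_integral => //.
  - by move=> p _; rewrite patchE; case: ifP => // _; rewrite lee_fin sq_quotient_ge0.
  - exact: ((measurable_restrictT _ mS).1 (measurable_funTS (msq _ mus))).
  - by apply: emeasurable_funD => //; exact: mA.
  move=> p _; rewrite patchE; case: ifP => [|_]; last by rewrite adde_ge0// lee_fin.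
  rewrite inE /S/= => p1.
  have [pd|pd] := ltP (enorm (p.1 - p.2)) del.
    rewrite -[leLHS]add0e leeD ?lee_fin// indicE mem_set ?mulr1//.
  rewrite -[leLHS]adde0 leeD// lee_fin /A1 /k1 indicE mem_set ?mulr1; last first.
    by rewrite /near_diagonal/=; lra.
  rewrite /sq_quotient real_normK ?num_real// (mulrC (del ^- N)) mulrA.
  apply: ler_pM; rewrite ?sqr_ge0 ?enormVn_ge0 ?enormVn_le// /g.
  by have := sqr_ge0 (us p.1 + us p.2); move: (us p.1) (us p.2) => s t; nra.
rewrite ge0_integralD//; last 2 first.
- by move=> p _; rewrite lee_fin.
- exact: mA.
apply: lte_add_pinfty.
  apply: le_lt_trans schur1 _; apply: lte_mul_pinfty => //.
  by rewrite lee_fin addr_ge0 // mulr_ge0// mulr_ge0// exprn_ge0.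
rewrite (@integral2_inversion _ _ x0 r N_gt0 r_gt0)//.
pose F : 'rV[R]_N * 'rV[R]_N -> \bar R := (fun p => (sq_quotient u p)%:E) \_ S.
have mF : measurable_fun setT F.
  exact: ((measurable_restrictT _ mS).1 (measurable_funTS (msq _ mfu))).
have F0 p : (0 <= F p)%E.
  by rewrite /F patchE; case: ifP => // _; rewrite lee_fin sq_quotient_ge0.
have mFA : measurable_fun setT (fun p => F p + (A2 p)%:E)%E.
  by apply: emeasurable_funD => //; exact: mA.
have FA0 p : (0 <= F p + (A2 p)%:E)%E by rewrite adde_ge0// lee_fin.
have mi : measurable_fun setT inv by exact: measurable_inversion.
have mJ : measurable_fun setT J by exact: measurable_inversion_jacobian.
apply: (@le_lt_trans _ _ (\int[mu \x mu]_p (C%:E * (F p + (A2 p)%:E)))%E).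
  apply: ge0_le_integral => //.
  - by move=> p _; rewrite mule_ge0// lee_fin mulr_ge0// inversion_jacobian_ge0.
  - apply: emeasurable_funM.
      apply: (measurableT_comp mB); apply: measurable_fun_pair.
        exact: (measurableT_comp mi).
      exact: (measurableT_comp mi).
    apply/measurable_EFinP; apply: measurable_funM.
      exact: (measurableT_comp mJ measurable_fst).
    exact: (measurableT_comp mJ measurable_snd).
  - exact: measurable_funeM.
  move=> [x z] _; rewrite /B /= -EFinM.
  have rhs0 : (0 <= C%:E * (F (x, z) + (A2 (x, z))%:E))%E by rewrite mule_ge0.
  have [e|xx0] := eqVneq x x0.
    by rewrite [J x](_ : _ = 0) ?mul0r ?mulr0// e inversion_jacobian_center.
  have [e|zx0] := eqVneq z x0.
    by rewrite [J z](_ : _ = 0) ?mulr0// e inversion_jacobian_center.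
  have [xzd|xzd] := boolP ((inv x, inv z) \in near_diagonal del); last first.
    by rewrite indicE (negbTE xzd) mulr0 mul0r.
  rewrite indicE xzd mulr1; move: xzd; rewrite inE /near_diagonal/= => xzd.
  have shell_half y : U y -> shell (d / 2) (2 * D) y.
    by move=> /US /andP[? ?]; apply/andP; split; lra.
  have close : shell (d / 2) (2 * D) x -> shell (d / 2) (2 * D) z -> enorm (x - z) < 1 ->
      ((sq_quotient us (inv x, inv z) * (J x * J z))%:E <=
       C%:E * (F (x, z) + (A2 (x, z))%:E))%E.
    move=> xS zS xz1.
    rewrite /F patchE mem_set; last by rewrite /S/= ltW.
    rewrite -EFinD -EFinM lee_fin (le_trans (HC u x z xS zS (ltW xz1)))//.
    rewrite ler_wpM2l// lerD2l /A2 /k2 indicE mem_set// mulr1 /=.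
    by rewrite ler_wpM2r ?potential_ge0// lerDr.
  have [Ux|nUx] := pselect (U x).
    have [] := near x (inv z) (US _ Ux); first by rewrite enormC.
    rewrite inversionK// => zS zx1; apply: close => //; first exact: shell_half.
    by rewrite enormC.
  have [Uz|nUz] := pselect (U z).
    have [] := near z (inv x) (US _ Uz); first by [].
    by rewrite inversionK// => xS xz1; apply: close => //; exact: shell_half.
  rewrite /sq_quotient /us /= !kelvin_inversion// !u_out// !mulr0 subrr normr0.
  by rewrite expr0n !mul0r.
rewrite ge0_integralZl//.
apply: lte_mul_pinfty => //.
rewrite ge0_integralD//; last 2 first.
- by move=> p _; rewrite lee_fin.
- exact: mA.
apply: lte_add_pinfty.
  by rewrite /F -integral_mkcond; exact: uH.
apply: le_lt_trans schur2 _; apply: lte_mul_pinfty => //.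
by rewrite lee_fin addr_ge0.
Qed.

End kelvin_energy.

(** * The transformation theorem *)

Lemma shell_of_closure {R : realType} {N : nat} (x0 : 'rV[R]_N) (U : set 'rV[R]_N) :
  bounded_set U -> ~ closure U x0 ->
  exists d D, [/\ 0 < d, d <= D & U `<=` shell x0 d D].
Proof.
move=> bU nU; have [D D0 UD] := bounded_set_enorm x0 bU.
have oC : open (~` closure U) by apply: closed_openC; exact: closed_closure.
have [e e0 eU] := (openE_eball _).1 oC x0 nU.
exists (Num.min e D), D; split; first by rewrite lt_min e0.
  by rewrite ge_min lexx orbT.
move=> z Uz; apply/andP; split; last exact: UD.
rewrite ge_min leNgt; apply/orP; left; apply/negP => ze.
by apply: (eU z ze); exact: subset_closure.
Qed.

Lemma shell_of_eball {R : realType} {N : nat} (x0 : 'rV[R]_N) r (U : set 'rV[R]_N) :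
  0 < r -> bounded_set U -> eball x0 r `<=` ~` U ->
  exists d D, [/\ 0 < d, d <= D & U `<=` shell x0 d D].
Proof.
move=> r0 bU rU; apply: shell_of_closure => // cU.
have [|z [Uz /rU]//] := cU (eball x0 r).
by apply/nbhs_eballP; exists r.
Qed.

Unset Implicit Arguments.

Theorem proposition1p3 (R : realType) (N : nat) (N_gt0 : (0 < N)%N)
    (x0 : 'rV[R]_N) (r : R) (r_gt0 : 0 < r)
    (Omega : set 'rV[R]_N) (open_Omega : open Omega)
    (bounded_Omega : bounded_set Omega) (lip_Omega : lipschitz_set Omega)
    (u : 'rV[R]_N -> R) (measurable_u : measurable_fun [set: 'rV[R]_N] u)
    (u_out : forall x, ~ Omega x -> u x = 0) :
  let us := kelvin x0 r u in
  let Omegas := inversion_set x0 r Omega in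
  [/\ (forall x, x != x0 -> dini_continuous u x ->
        let xs := inversion x0 r x in
        dini_continuous us xs /\
        ((lebesgue_rV N).-integrable [set: 'rV[R]_N] (EFin \o u) ->
         u x = 0 \/ ~ closure Omega x0 ->
         [/\ loglap_defined u x, loglap_defined us xs,
             (u x != 0 ->
              [/\ h_defined Omega x, h_defined Omegas xs &
                  (lebesgue_rV N).-integrable Omega
                    (EFin \o kelvin_kernel x0 x)]) &
             loglap us xs =
               enorm (xs - x0) ^- N * loglap u x
               + c_ N * r ^+ (2 * N) * enorm (xs - x0) ^- (2 * N) * u x *
                 \int[lebesgue_rV N]_(z in Omega) kelvin_kernel x0 x z
               + (h_ Omegas xs - h_ Omega x) * enorm (xs - x0) ^- N * u x])),
      (in_Linfty Omega u ->
       {ae lebesgue_rV N, forall x, Omega x -> loglap_defined u x} ->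
       in_Linfty Omega (loglap u) ->
       eball x0 r `<=` ~` Omega ->
       [/\ in_Linfty Omegas us,
           {ae lebesgue_rV N, forall x, Omegas x -> loglap_defined us x} &
           in_Linfty Omegas (loglap us)]) &
      (eball x0 r `<=` ~` Omega -> in_H Omega u -> in_H Omegas us)].
Proof.
move=> us Omegas; have mO := measurable_open open_Omega.
split=> [x xx0 du xs||].
- split; first exact: dini_kelvin.
  move=> iu ux_or.
  have lu : loglap_defined u x by exact: dini_loglap_defined.
  have hx : u x != 0 -> [/\ h_defined Omega x, h_defined Omegas xs &
      (lebesgue_rV N).-integrable Omega (EFin \o kelvin_kernel x0 x)].
    move=> ux0; have nO : ~ closure Omega x0.
      by case: ux_or => // ux; rewrite ux eqxx in ux0.
    have [d [D [d0 dD OS]]] := shell_of_closure bounded_Omega nO.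
    have Ox : Omega x by apply: contrapT => /u_out ux; rewrite ux eqxx in ux0.
    have oOs := @open_inversion_set _ _ x0 r r_gt0 _ open_Omega.
    have mOs := measurable_open oOs.
    have OsS := @shell_inversion_set _ _ x0 r r_gt0 _ _ _ d0 OS.
    have Oxs : Omegas xs by exists x => //; split => //; exact/eqP.
    split.
    + have [e e0 eO] := (openE_eball _).1 open_Omega x Ox.
      exact: h_defined_interior mO (shell_lty mO OS) e0 eO.
    + have [e e0 eO] := (openE_eball _).1 oOs xs Oxs.
      exact: h_defined_interior mOs (shell_lty mOs OsS) e0 eO.
    + exact: (integrable_kelvin_kernel N_gt0 d0 mO OS (OS x Ox)).
  have [lus E] := kelvin_loglap N_gt0 r_gt0 mO measurable_u u_out xx0 hx lu.
  by split.
- move=> uL lu luL rO; have [d [D [d0 dD OS]]] := shell_of_eball r_gt0 bounded_Omega rO.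
  exact: (kelvin_Linfty N_gt0 r_gt0 d0 dD open_Omega OS measurable_u u_out uL lu luL).
- move=> rO uH; have [d [D [d0 dD OS]]] := shell_of_eball r_gt0 bounded_Omega rO.
  exact: (kelvin_in_H N_gt0 r_gt0 d0 dD mO OS uH).
Qed.
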